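(* Suppose that $\aleph_\omega$ is a strong limit cardinal. For every positive integer $n$ and for all infinite cardinals $\mu\le\theta<\aleph_\omega$, there are a regular uncountable cardinal $\kappa<\aleph_\omega$, a $\mu$-bounded ladder system $\vec L=\langle A_\delta\mid\delta\in E^\kappa_\mu\rangle$ and a map $g:\kappa\rightarrow\theta$ such that for every function $f:[\kappa]^n\rightarrow\theta$, there are stationarily many $\delta\in E^\kappa_\mu$ such that $f``[A_\delta]^n=\{g(\delta)\}$.
   Context: Work in ZFC. $E^\kappa_\mu:=\{\delta<\kappa\mid\operatorname{cf}(\delta)=\mu\}$. For a set of ordinals $X$ and an integer $n\ge 2$, $[X]^n$ is identified with the set of tuples $(\alpha_1,\ldots,\alpha_n)$ with $\alpha_1<\cdots<\alpha_n$ all from $X$; for $n=1$, $[X]^1$ is identified with $X$. $f``Y$ denotes the image $\{f(y)\mid y\in Y\}$. For a regular uncountable cardinal $\kappa$, a ladder system over a stationary $S\subseteq\kappa$ is a sequence $\langle A_\delta\mid\delta\in S\rangle$ such that each $A_\delta$ is a cofinal subset of $\delta$; it is $\xi$-bounded iff $\operatorname{otp}(A_\delta)\le\xi$ for all $\delta\in S$. ''Stationarily many $\delta\in S$'' means that the set of such $\delta$ is a stationary subset of $\kappa$. *)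

(* Defs.v *)
From HB Require Import structures.
From mathcomp Require Import all_boot all_order.
From mathcomp Require Import boolp classical_sets functions cardinality.
From mathcomp Require wochoice.

Set Implicit Arguments.
Unset Strict Implicit.
Unset Printing Implicit Defensive.

Import Order.TTheory.

Local Open Scope classical_set_scope.
Local Open Scope card_scope.

(* The carrier is a bare [Type]: bundling a MathComp structure here would put
   [Ord] in a universe too large to carry an [orderType] instance. *)
Record wellOrder := WellOrder {
  wo_car :> Type;
  wo_lt : wo_car -> wo_car -> Prop;
  wo_wf : well_founded wo_lt;
  wo_trans : forall x y z, wo_lt x y -> wo_lt y z -> wo_lt x z;
  wo_total : forall x y, [\/ wo_lt x y, x = y | wo_lt y x] }.

Arguments wo_lt {w}.

HB.instance Definition _ := gen_eqMixin wellOrder.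
HB.instance Definition _ := gen_choiceMixin wellOrder.

Definition wo_mono (v w : wellOrder) (f : v -> w) :=
  forall x y, wo_lt x y -> wo_lt (f x) (f y).

Definition wo_iso (v w : wellOrder) : bool :=
  `[< exists (f : v -> w) (g : w -> v),
        [/\ wo_mono f, wo_mono g, cancel f g & cancel g f] >].

Definition initial_embedding (v w : wellOrder) (f : v -> w) :=
  wo_mono f /\ forall x z, wo_lt z (f x) -> exists y, f y = z.

Definition wo_le (v w : wellOrder) : bool :=
  `[< exists f : v -> w, initial_embedding f >].

Lemma wo_irr (w : wellOrder) (x : w) : ~ wo_lt x x.
Proof. by elim/(well_founded_ind (@wo_wf w)): x => x IH xx; exact: (IH x). Qed.

Lemma wo_asym (w : wellOrder) (x y : w) : wo_lt x y -> ~ wo_lt y x.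
Proof. by move=> xy yx; exact: (wo_irr (wo_trans xy yx)). Qed.

Lemma wo_monoI (v w : wellOrder) (f : v -> w) : wo_mono f ->
  forall x y, wo_lt (f x) (f y) -> wo_lt x y.
Proof.
move=> fm x y fxy; case: (wo_total x y) => // [xy|/fm /(wo_asym fxy) //].
by move: fxy; rewrite xy => /wo_irr.
Qed.

Lemma wo_isoxx : reflexive wo_iso.
Proof. by move=> w; apply/asboolP; exists id, id; split. Qed.

Lemma wo_iso_sym : symmetric wo_iso.
Proof.
suff H v w : wo_iso v w -> wo_iso w v by move=> v w; apply/idP/idP; exact: H.
by move=> /asboolP[f [g [fm gm fg gf]]]; apply/asboolP; exists g, f.
Qed.

Lemma wo_iso_trans : transitive wo_iso.
Proof.
move=> v u w /asboolP[f [g [fm gm fg gf]]] /asboolP[f' [g' [fm' gm' fg' gf']]].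
apply/asboolP; exists (f' \o f), (g \o g'); split.
- by move=> x y /fm /fm'.
- by move=> x y /gm' /gm.
- exact: can_comp.
- exact: can_comp.
Qed.

Lemma wo_iso_le v w : wo_iso v w -> wo_le v w.
Proof.
move=> /asboolP[f [g [fm gm fg gf]]]; apply/asboolP; exists f; split => //.
by move=> x z _; exists (g z).
Qed.

Lemma wo_le_trans : transitive wo_le.
Proof.
move=> v u w /asboolP[f [fm fi]] /asboolP[g [gm gi]].
apply/asboolP; exists (g \o f); split=> [x y /fm /gm //|x z /= zx].
have [y yz] := gi _ _ zx; move: zx; rewrite -yz => /(wo_monoI gm) /fi[t <-].
by exists t.
Qed.

Lemma initial_embedding_uniq (v w : wellOrder) (f g : v -> w) :
  initial_embedding f -> initial_embedding g -> f =1 g.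
Proof.
move=> [fm fi] [gm gi].
elim/(well_founded_ind (@wo_wf v)) => x IH.
case: (wo_total (f x) (g x)) => // h.
  have [y yE] := gi _ _ h.
  have yx : wo_lt y x by apply: (wo_monoI gm); rewrite yE.
  by have := fm _ _ yx; rewrite IH // yE => /wo_irr.
have [y yE] := fi _ _ h.
have yx : wo_lt y x by apply: (wo_monoI fm); rewrite yE.
by have := gm _ _ yx; rewrite -IH // yE => /wo_irr.
Qed.

Lemma wo_le_anti v w : wo_le v w -> wo_le w v -> wo_iso v w.
Proof.
have gen (v' w' : wellOrder) (h : v' -> w') (k : w' -> v') :
    initial_embedding h -> initial_embedding k -> cancel h k.
  move=> [hm hi] [km ki]; apply: (@initial_embedding_uniq v' v' (k \o h) id).
    split=> [x y /hm /km //|x z /= zx].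
    have [y yz] := ki _ _ zx; move: zx; rewrite -yz => /(wo_monoI km) /hi[t <-].
    by exists t.
  by split => // x z _; exists z.
move=> /asboolP[f fi] /asboolP[g gi]; apply/asboolP; exists f, g.
by split; [exact: fi.1|exact: gi.1|exact: gen|exact: gen].
Qed.

(* [wo_match x y]: the segments below [x] and [y] are isomorphic. *)
Inductive wo_match (v w : wellOrder) : v -> w -> Prop := WoMatch x y of
  (forall x', wo_lt x' x -> exists2 y', wo_lt y' y & wo_match x' y') &
  (forall y', wo_lt y' y -> exists2 x', wo_lt x' x & wo_match x' y') :
  wo_match x y.

Lemma wo_match_inv (v w : wellOrder) (x : v) (y : w) : wo_match x y ->
  (forall x', wo_lt x' x -> exists2 y', wo_lt y' y & wo_match x' y') /\
  (forall y', wo_lt y' y -> exists2 x', wo_lt x' x & wo_match x' y').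
Proof. by case. Qed.

Lemma wo_match_fun (v w : wellOrder) (x : v) (y y' : w) :
  wo_match x y -> wo_match x y' -> y = y'.
Proof.
elim/(well_founded_ind (@wo_wf v)): x y y' => x IH y y'.
move=> /wo_match_inv[xy yx] /wo_match_inv[xy' yx'].
case: (wo_total y y') => // yy'.
  have [x' x'x x'y] := yx' _ yy'; have [y2 y2y x'y2] := xy _ x'x.
  by move: y2y; rewrite (IH _ x'x _ _ x'y2 x'y) => /wo_irr.
have [x' x'x x'y] := yx _ yy'; have [y2 y2y x'y2] := xy' _ x'x.
by move: y2y; rewrite (IH _ x'x _ _ x'y2 x'y) => /wo_irr.
Qed.

Lemma wo_match_sym (v w : wellOrder) (x : v) (y : w) : wo_match x y -> wo_match y x.
Proof.
elim/(well_founded_ind (@wo_wf v)): x y => x IH y /wo_match_inv[xy yx].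
constructor.
  by move=> y' /yx[x' x'x m]; exists x' => //; exact: IH.
by move=> x' x'x; have [y' y'y m] := xy _ x'x; exists y' => //; exact: IH.
Qed.

Lemma wo_match_mono (v w : wellOrder) (x x' : v) (y y' : w) :
  wo_match x y -> wo_match x' y' -> wo_lt x x' -> wo_lt y y'.
Proof.
move=> m /wo_match_inv[xy _] xx'.
by have [y2 y2y m2] := xy _ xx'; rewrite (wo_match_fun m m2).
Qed.

Lemma wo_match_down (v w : wellOrder) (x : v) (y y' : w) :
  wo_match x y -> wo_lt y' y -> exists x' : v, wo_match x' y'.
Proof. by move=> /wo_match_inv[_ yx] /yx[x' _ m]; exists x'. Qed.

Lemma wo_match_le (v w : wellOrder) :
  (forall x : v, exists y : w, wo_match x y) -> wo_le v w.
Proof.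
move=> /choice[f fP]; apply/asboolP; exists f; split.
  by move=> x y; exact: wo_match_mono.
move=> x z zx; have [x' m] := wo_match_down (fP x) zx.
by exists x'; exact: wo_match_fun (fP x') m.
Qed.

Lemma wo_min (w : wellOrder) (P : w -> Prop) : (exists x, P x) ->
  exists x, P x /\ forall y, wo_lt y x -> ~ P y.
Proof.
move=> [x Px]; apply: contrapT => nex; move: Px.
elim/(well_founded_ind (@wo_wf w)): x => x IH Px.
by apply: nex; exists x; split.
Qed.

Lemma wo_le_total : total wo_le.
Proof.
move=> v w.
have [vw|/existsNP/wo_min[x [xN xm]]] :=
  pselect (forall x : v, exists y : w, wo_match x y).
  by rewrite wo_match_le.
have [wv|/existsNP/wo_min[y [yN ym]]] :=
  pselect (forall y : w, exists x : v, wo_match y x).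
  by rewrite (wo_match_le wv) orbT.
exfalso; apply: (xN); exists y; constructor.
  move=> x' x'x; have [y' m] := contrapT (xm _ x'x).
  exists y' => //; case: (wo_total y' y) => // [yy|yy']; exfalso; apply: yN.
    by exists x'; rewrite -yy; exact: wo_match_sym.
  have [x2 m2] := wo_match_down m yy'.
  by exists x2; exact: wo_match_sym.
move=> y' y'y; have [x' m] := contrapT (ym _ y'y).
exists x'; last exact: wo_match_sym.
case: (wo_total x' x) => // [xx|xx']; exfalso; apply: xN.
  by exists y'; rewrite -xx; exact: wo_match_sym.
have [y2 m2] := wo_match_down m xx'.
by exists y2; exact: wo_match_sym.
Qed.

Canonical wo_iso_equiv := EquivRel wo_iso wo_isoxx wo_iso_sym wo_iso_trans.

(* An ordinal is a well-ordered type up to isomorphism; it is represented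
   below, in the von Neumann style, by the set [below a] of its predecessors. *)
Definition Ord : Type := {eq_quot wo_iso}%qT.
HB.instance Definition _ := Quotient.on Ord.
HB.instance Definition _ := EqQuotient.on Ord.
HB.instance Definition _ := Choice.on Ord.

Definition Ord_le (a b : Ord) : bool := wo_le (repr a) (repr b).

Lemma Ord_lexx : reflexive Ord_le.
Proof. by move=> a; exact: wo_iso_le (wo_isoxx _). Qed.

Lemma Ord_le_anti : antisymmetric Ord_le.
Proof.
move=> a b /andP[ab ba]; rewrite -[a]reprK -[b]reprK.
by apply/eqmodP; exact: wo_le_anti.
Qed.

Lemma Ord_le_trans : transitive Ord_le.
Proof. by move=> b a c; exact: wo_le_trans. Qed.

Fact Ord_display : Order.disp_t. Proof. exact: Order.Disp tt tt. Qed.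

HB.instance Definition _ :=
  Order.Le_isPOrder.Build Ord_display Ord Ord_lexx Ord_le_anti Ord_le_trans.

Lemma Ord_le_total : total (<=%O : rel Ord).
Proof. by move=> a b; exact: wo_le_total. Qed.

HB.instance Definition _ :=
  Order.POrder_isTotal.Build Ord_display Ord Ord_le_total.

Section initial_segments.
Variable w : wellOrder.

Definition seg_lt (x : w) (y z : {y : w | wo_lt y x}) :=
  wo_lt (sval y) (sval z).

Lemma seg_lt_wf x : well_founded (@seg_lt x).
Proof.
move=> [y yx]; elim/(well_founded_ind (@wo_wf w)): y yx => y IH yx.
by constructor=> -[z zx] /IH; exact.
Qed.

Lemma seg_lt_trans x (a b c : {y : w | wo_lt y x}) :
  seg_lt a b -> seg_lt b c -> seg_lt a c.
Proof. exact: wo_trans. Qed.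

Lemma seg_lt_total x (a b : {y : w | wo_lt y x}) :
  [\/ seg_lt a b, a = b | seg_lt b a].
Proof.
case: a b => [a ax] [b bx]; rewrite /seg_lt /=.
case: (wo_total a b) => [ab|ab|ba]; [exact: Or31|apply: Or32|exact: Or33].
by apply: eq_exist.
Qed.

Definition wo_seg (x : w) : wellOrder :=
  WellOrder (@seg_lt_wf x) (@seg_lt_trans x) (@seg_lt_total x).

End initial_segments.

Definition ord_of (w : wellOrder) : Ord := \pi_Ord%qT w.

Lemma ord_of_eq v w : (ord_of v = ord_of w) <-> wo_iso v w.
Proof. by split=> [/eqmodP|h]; last apply/eqmodP. Qed.

Lemma ord_of_le v w : (ord_of v <= ord_of w)%O = wo_le v w.
Proof.
have E u : wo_iso (repr (ord_of u)) u by apply/ord_of_eq; rewrite [LHS]reprK.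
have E' u : wo_iso u (repr (ord_of u)) by rewrite wo_iso_sym.
apply/idP/idP => [h|h].
  exact: wo_le_trans (wo_iso_le (E' v)) (wo_le_trans h (wo_iso_le (E w))).
exact: wo_le_trans (wo_iso_le (E v)) (wo_le_trans h (wo_iso_le (E' w))).
Qed.

Lemma ord_of_surj a : exists w, a = ord_of w.
Proof. by exists (repr a); rewrite [RHS]reprK. Qed.

Lemma initial_embedding_seg (w : wellOrder) (x : w) :
  initial_embedding (fun y : wo_seg x => sval y).
Proof. by split => // -[y yx] z /= zy; exists (exist _ z (wo_trans zy yx)). Qed.

Lemma lt_ord_of a (w : wellOrder) :
  (a < ord_of w)%O <-> exists x : w, a = ord_of (wo_seg x).
Proof.
have [v ->] := ord_of_surj a; split => [|[x ->]].
  rewrite ltNge ord_of_le => /negP wv.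
  have := wo_le_total v w; case/orP => [vw|/wv //].
  move/asboolP: (vw) => [f [fm fi]].
  have [sf|/existsNP/wo_min[x [xN xm]]] := pselect (forall y, exists x, f x = y).
    exfalso; apply: wv; move/choice: sf => [g gK]; apply/asboolP; exists g.
    split=> [x y xy|x z zx]; first by apply: (wo_monoI fm); rewrite !gK.
    exists (f z); have := gK (f z).
    case: (wo_total (g (f z)) z) => // /fm + E; rewrite E => /wo_irr //.
  exists x; apply/ord_of_eq/asboolP.
  have fx u : wo_lt (f u) x.
    case: (wo_total (f u) x) => // [ux|/fi[t tx]]; exfalso; apply: xN.
      by exists u.
    by exists t.
  have /choice[g gK] (y : wo_seg x) : exists u, f u = sval y.
    by case: y => y yx /=; exact: contrapT (xm _ yx).
  exists (fun u => exist _ (f u) (fx u)), g; split.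
  - by move=> u u' /fm.
  - by move=> u u' uu'; apply: (wo_monoI fm); rewrite !gK.
  - move=> u; have /= := gK (exist _ (f u) (fx u)).
    set t := g _; case: (wo_total t u) => // /fm + E; rewrite E => /wo_irr //.
  - move=> u; have := gK u; case: u => u ux /= gu.
    by apply: eq_exist.
rewrite ltNge ord_of_le; apply/negP => /asboolP[f fi].
have := @initial_embedding_uniq w w (fun y => sval (f y)) id.
case: fi => fm fi /(_ _ _ x) /= fx.
have := svalP (f x); rewrite /= fx; first exact: wo_irr.
- split=> [y z /fm //|y z zy].
  have /fi[t tE] : wo_lt (exist _ z (wo_trans zy (svalP (f y))) : wo_seg x) (f y) by [].
  by exists t; rewrite tE.
- by split => // y z _; exists z.
Qed.

Lemma Ord_lt_wf : well_founded (fun a b : Ord => (a < b)%O).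
Proof.
have H (w : wellOrder) (x : w) : Acc (fun a b : Ord => (a < b)%O) (ord_of (wo_seg x)).
  elim/(well_founded_ind (@wo_wf w)): x => x IH; constructor => a.
  move=> /lt_ord_of[[z zx] ->]; have := IH z zx; congr (Acc _ _).
  apply/ord_of_eq/asboolP.
  exists (fun y : wo_seg z =>
    exist _ (exist (fun t => wo_lt t x) (sval y) (wo_trans (svalP y) zx)) (svalP y)
      : @wo_seg (wo_seg x) (exist _ z zx)).
  exists (fun y : @wo_seg (wo_seg x) (exist _ z zx) =>
    exist _ (sval (sval y)) (svalP y)).
  split=> //; first by move=> [y yz] /=; exact: eq_exist.
  by move=> [[y yx] yz]; apply: eq_exist; exact: eq_exist.
move=> a; have [w ->] := ord_of_surj a.
by constructor=> b /lt_ord_of[x ->].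
Qed.

Lemma void_wf : well_founded (fun _ _ : void => False).
Proof. by case. Qed.

Definition ord0 : Ord := ord_of (@WellOrder void (fun _ _ => False) void_wf
  ltac:(by case) ltac:(by case)).

Definition below (a : Ord) : set Ord := [set x | (x < a)%O].

Definition least (S : set Ord) : Ord := xget ord0 (S `&` lbound S).

Lemma leastP (S : set Ord) : S !=set0 -> (S `&` lbound S) (least S).
Proof.
move=> [a Sa]; apply: xgetPex; elim/(well_founded_ind Ord_lt_wf): a Sa => a IH Sa.
have [lb|/existsNP[b /not_implyP[Sb /negP]]] := pselect (lbound S a).
  by exists a.
by rewrite -ltNge => /IH; exact.
Qed.

Definition is_cardinal (a : Ord) := forall b, (b < a)%O -> below b #!= below a.

Lemma below_wo (w : wellOrder) : exists h : w -> Ord,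
  [/\ forall x y, wo_lt x y -> (h x < h y)%O, injective h & range h = below (ord_of w)].
Proof.
have hm (x y : w) : wo_lt x y -> (ord_of (wo_seg x) < ord_of (wo_seg y))%O.
  move=> xy; apply/lt_ord_of; exists (exist _ x xy); apply/ord_of_eq/asboolP.
  exists (fun z : wo_seg x =>
    exist _ (exist (fun t => wo_lt t y) (sval z) (wo_trans (svalP z) xy)) (svalP z)
      : @wo_seg (wo_seg y) (exist _ x xy)).
  exists (fun z : @wo_seg (wo_seg y) (exist _ x xy) =>
    exist _ (sval (sval z)) (svalP z)).
  split=> //; first by move=> [z zx] /=; exact: eq_exist.
  by move=> [[z zy] zx]; apply: eq_exist; exact: eq_exist.
exists (fun x => ord_of (wo_seg x)); split => //.
- move=> x y xy; case: (wo_total x y) => // /hm; by rewrite xy ltxx.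
- apply/seteqP; split=> [_ [x _ <-]|a]; first by apply/lt_ord_of; exists x.
  by move=> /lt_ord_of[x ->]; exists x.
Qed.

Lemma below_card (w : wellOrder) : below (ord_of w) #= [set: w].
Proof.
have [h [_ hi <-]] := below_wo w.
by apply: inj_card_eq => x y _ _; exact: hi.
Qed.

Lemma wo_exists (T : Type) : exists w : wellOrder, [set: w] #= [set: T].
Proof.
have [R woR] := @wochoice.well_ordering_principle {classic T}.
pose lt (x y : {classic T}) := ~ R y x.
have tot (x y : {classic T}) : R x y \/ R y x.
  have [|z [[zA zl] _]] := woR ([pred z | (z == x) || (z == y)] : {pred {classic T}}).
    by exists x; rewrite inE eqxx.
  move: zA; rewrite !inE => /orP[] /eqP ez; [left|right];
    rewrite -{1}ez; apply: zl; by rewrite !inE eqxx ?orbT.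
have anti (x y : {classic T}) : R x y -> R y x -> x = y.
  move=> xy yx; have [|z [_ zu]] := woR ([pred z | (z == x) || (z == y)] : {pred {classic T}}).
    by exists x; rewrite inE eqxx.
  rewrite -(zu x) ?(zu y) //; split; rewrite ?inE ?eqxx ?orbT // => t;
  rewrite !inE => /orP[] /eqP -> //; by case: (tot x x); case: (tot y y).
have wf : well_founded lt.
  move=> x; apply: contrapT => nx.
  have [|z [[zA zl] _]] := woR (fun x : {classic T} => `[< ~ Acc lt x >]).
    by exists x; apply/asboolP.
  move/asboolP: zA; apply; constructor => y yz; apply: contrapT => ny.
  by apply: yz; apply: zl; apply/asboolP.
have asy x y : lt x y -> R x y by move=> nyx; case: (tot x y).
have tl x y : [\/ lt x y, x = y | lt y x].
  have [xy|] := pselect (R x y); last by move=> ?; apply: Or33.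
  have [yx|] := pselect (R y x); last by move=> ?; apply: Or31.
  by apply: Or32; exact: anti.
have tr x y z : lt x y -> lt y z -> lt x z.
  have wirr u : ~ lt u u by elim/(well_founded_ind wf): u => u IH uu; exact: (IH u).
  move=> xy yz; case: (tl x z) => // [xz|zx].
    by subst z; exfalso; apply: xy; exact: asy.
  exfalso; pose P := [pred t : {classic T} | [|| t == x, t == y | t == z]].
  have [|u [[uA ul] _]] := woR P; first by exists x; rewrite inE eqxx.
  move: uA; rewrite !inE => /or3P[] /eqP eu; subst u.
  - by apply: zx; apply: ul; rewrite !inE eqxx !orbT.
  - by apply: xy; apply: ul; rewrite !inE eqxx.
  - by apply: yz; apply: ul; rewrite !inE eqxx !orbT.
by exists (@WellOrder T lt wf tr tl).
Qed.

Lemma card_exists (T : Type) : exists a, is_cardinal a /\ below a #= [set: T].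
Proof.
have [w wT] := wo_exists T.
have := @leastP [set a | below a #= [set: T]]; case.
  by exists (ord_of w); exact: card_eq_trans (below_card w) wT.
set a := least _ => aT al; exists a; split=> // b ba; apply/negP => bca.
by have := al b (card_eq_trans bca aT); rewrite leNgt ba.
Qed.

Lemma cantor (T : Type) : ~ ([set: T -> Prop] #<= [set: T]).
Proof.
move=> /card_leP[f].
pose g (X : T -> Prop) : T := sval (f (exist _ X (in_setT X))).
have gi : injective g.
  move=> X Y /val_inj/(@inj _ _ _ f); rewrite !in_setT => /(_ isT isT) []//.
pose D := fun x => exists X, x = g X /\ ~ X x.
have nD : ~ D (g D) by move=> h; case: (h) => X [/gi <-].
by apply: (nD); exists D.
Qed.

Lemma below_subset a b : (a <= b)%O -> below a #<= below b.
Proof. by move=> ab; apply: subset_card_le => x /= xa; exact: lt_le_trans ab. Qed.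

Lemma next_cardinal a : exists b, is_cardinal b /\ (a < b)%O.
Proof.
have [w ->] := ord_of_surj a.
have [b [bc bT]] := card_exists (w -> Prop).
exists b; split => //; rewrite ltNge; apply/negP => bw; apply: (@cantor w).
have := below_card w; rewrite card_eq_le => /andP[bw' _].
move: bT; rewrite card_eq_le => /andP[_ bT].
apply: card_le_trans bT _; apply: card_le_trans bw'.
exact: below_subset.
Qed.

Definition infinite_cardinal (a : Ord) :=
  is_cardinal a /\ infinite_set (below a).

Fixpoint aleph (n : nat) : Ord :=
  if n is m.+1 then least [set a | is_cardinal a /\ (aleph m < a)%O]
  else least [set a | infinite_cardinal a].

Lemma aleph0P : [set a | infinite_cardinal a] (aleph 0) /\ lbound [set a | infinite_cardinal a] (aleph 0).
Proof.
apply: leastP; have [a [ac aT]] := card_exists nat; exists a; split => //.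
by move/eq_finite_set: aT => ->; exact: infinite_nat.
Qed.

Lemma alephSP n : is_cardinal (aleph n.+1) /\ (aleph n < aleph n.+1)%O.
Proof. by have [] := leastP (next_cardinal (aleph n)). Qed.

Definition aleph_omega : Ord := supremum ord0 (range aleph).

Fixpoint iter_pow (n : nat) : Type :=
  if n is m.+1 then iter_pow m -> Prop else nat.

Lemma aleph_iter_pow n : below (aleph n) #<= [set: iter_pow n].
Proof.
elim: n => [|n IH].
  have [b [bc bT]] := card_exists nat.
  have bT' : below b #<= [set: nat] by move: bT; rewrite card_eq_le => /andP[].
  apply: card_le_trans bT'; apply: below_subset; apply: aleph0P.2; split=> //=.
  by rewrite (eq_finite_set bT); exact: infinite_nat.
have [b [bc bT]] := card_exists (iter_pow n.+1).
move: bT; rewrite card_eq_le => /andP[bT bT'].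
have [nb|bn] := ltP (aleph n) b.
  apply: card_le_trans bT; apply: below_subset.
  by have [_] := leastP (next_cardinal (aleph n)); apply.
exfalso; apply: (@cantor (iter_pow n)); apply: card_le_trans bT' _.
by apply: card_le_trans IH; exact: below_subset.
Qed.

Lemma aleph_omegaP : supremums (range aleph) aleph_omega.
Proof.
rewrite /aleph_omega /supremum ifF; last first.
  by apply/negP => /eqP/seteqP[+ _] => /(_ (aleph 0)); apply; exists 0%N.
have [b [bc bT]] := card_exists {n & iter_pow n -> Prop}.
have [|ub lb] := @leastP (ubound (range aleph)).
  exists b => _ [n _ <-]; rewrite leNgt; apply/negP => /ltW/below_subset bn.
  apply: (@cantor (iter_pow n)); apply: card_le_trans (aleph_iter_pow n).
  apply: card_le_trans bn; move: bT; rewrite card_eq_le => /andP[_].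
  apply: card_le_trans.
  pose i (X : iter_pow n -> Prop) : {m & iter_pow m -> Prop} := existT _ n X.
  have : range i #= [set: iter_pow n -> Prop].
    by apply: inj_card_eq => X Y _ _; exact: eq_from_Tagged.
  rewrite card_eq_le => /andP[_ /card_le_trans]; apply.
  exact: subset_card_le.
by apply: xgetPex; exists (least (ubound (range aleph))).
Qed.

(* For sets, [~ (A #<= B)] says that the cardinality of [B] is smaller than
   that of [A]. *)
Definition strong_limit (a : Ord) :=
  infinite_cardinal a /\
  forall b, is_cardinal b -> (b < a)%O ->
    ~ (below a #<= [set X : set Ord | X `<=` below b]).

(* Meaningful when [X] is bounded (see [otpP]); a proper class of ordinals
   has no order type and gets the junk value [ord0]. *)
Definition otp (X : set Ord) : Ord :=
  xget ord0 [set a | exists2 h : Ord -> Ord, set_bij (below a) X h &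
    forall x y, below a x -> below a y -> (x < y)%O -> (h x < h y)%O].

Lemma otpP a (X : set Ord) : X `<=` below a ->
  exists2 h : Ord -> Ord, set_bij (below (otp X)) X h &
    forall x y, below (otp X) x -> below (otp X) y -> (x < y)%O -> (h x < h y)%O.
Proof.
have [w ->] := ord_of_surj a => Xw.
suff [b bP] : [set a | exists2 h : Ord -> Ord, set_bij (below a) X h &
    forall x y, below a x -> below a y -> (x < y)%O -> (h x < h y)%O] !=set0.
  exact: xgetI bP.
have [k [km ki kr]] := below_wo w.
pose lt (x y : {x : w | X (k x)}) := wo_lt (sval x) (sval y).
have lt_wf : well_founded lt.
  move=> [x xX]; elim/(well_founded_ind (@wo_wf w)): x xX => x IH xX.
  by constructor=> -[y yX] /IH; exact.
have lt_tr x y z : lt x y -> lt y z -> lt x z by exact: wo_trans.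
have lt_tot x y : [\/ lt x y, x = y | lt y x].
  case: x y => [x xX] [y yX]; rewrite /lt /=.
  case: (wo_total x y) => [xy|xy|yx]; [exact: Or31|apply: Or32|exact: Or33].
  exact: eq_exist.
pose v := WellOrder lt_wf lt_tr lt_tot.
have [l [lm li lr]] := below_wo v.
pose h x := xget ord0 [set z | exists2 y : v, l y = x & k (sval y) = z].
have hl y : h (l y) = k (sval y).
  by apply: xget_unique => [|z [y' /li -> //]]; exists y.
exists (ord_of v), h; rewrite -lr.
  split=> [_ [y _ <-]|_ _ /set_mem[y _ <-] /set_mem[z _ <-]|x Xx].
  - by rewrite hl; case: y.
  - by rewrite !hl => /ki yz; congr l; apply: eq_sig_hprop => // ? ? ?; exact: Prop_irrelevance.
  - have : below (ord_of w) x by exact: Xw.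
    rewrite -kr => -[y _ yx]; move: (Xx); rewrite -yx => Xy.
    by exists (l (exist _ y Xy)); [exists (exist _ y Xy)|rewrite hl].
move=> _ _ [y _ <-] [z _ <-] lyz; rewrite !hl; apply: km.
case: (@wo_total v y z) lyz => // [->|/lm zy]; first by rewrite ltxx.
by rewrite ltNge (ltW zy).
Qed.

Definition cofinal_in (a : Ord) (X : set Ord) :=
  X `<=` below a /\ forall x, (x < a)%O -> exists2 y, X y & (x <= y)%O.

Definition cf (a : Ord) : Ord := least [set otp X | X in cofinal_in a].

Definition regular_cardinal (a : Ord) := infinite_cardinal a /\ cf a = a.

Definition cof_set (kappa mu : Ord) : set Ord :=
  [set d | (d < kappa)%O /\ cf d = mu].

(* The second condition is closure: [d] ranges over the ordinals below [kappa]
   that are limits of elements of [C]. *)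
Definition club (kappa : Ord) (C : set Ord) :=
  cofinal_in kappa C /\
  forall d, (ord0 < d)%O -> (d < kappa)%O ->
    (forall x, (x < d)%O -> exists y, [/\ C y, (x < y)%O & (y < d)%O]) -> C d.

Definition stationary (kappa : Ord) (S : set Ord) :=
  S `<=` below kappa /\ forall C, club kappa C -> S `&` C !=set0.

(* The values [A d] for [d] outside [S] are irrelevant. *)
Definition ladder_system (kappa : Ord) (S : set Ord) (A : Ord -> set Ord) :=
  stationary kappa S /\ forall d, S d -> cofinal_in d (A d).

Definition bounded_ladder (xi : Ord) (S : set Ord) (A : Ord -> set Ord) :=
  forall d, S d -> (otp (A d) <= xi)%O.

(* [X]^n; for n = 1 a point is a 1-tuple. *)
Definition increasing_tuples (n : nat) (X : set Ord) : set (n.-tuple Ord) :=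
  [set t | sorted <%O t /\ forall x, x \in t -> X x].

Arguments increasing_tuples n X : clear implicits.

(* Main.v *)
Require Import Defs.
From HB Require Import structures.
From mathcomp Require Import all_boot all_order.
From mathcomp Require Import boolp classical_sets functions cardinality.

Set Implicit Arguments.
Unset Strict Implicit.
Unset Printing Implicit Defensive.

Local Open Scope classical_set_scope.

(** The theorem combines Shelah's middle diamond with the Erdos-Rado theorem.

    Fix [n], [mu = aleph m] and [theta]. The cardinal [kappa] is the size of the
    power set [Y] of a set [K] that is itself a power set far larger than [theta]
    and than an auxiliary [aleph l > mu]. Below a strong limit [aleph_omega] this
    [kappa] is some [aleph k.+1], and [aleph k] to the power [aleph l] is
    [aleph k] ([card_fun_aleph]).

    Candidate ladders. Inject every [d < kappa] into [aleph k] by [e d]. One small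
    set of traces in [aleph k] works for all clubs ([guess_trace]): every club
    contains a continuous sequence [x] of length [aleph l] such that
    [e (x t) (x s)] is a trace whenever [s < t]. Thus the part of [x] before
    [x t] can be read off from [x t] and a set of traces, without knowing the
    club. Applied to [x], the Erdos-Rado theorem produces a homogeneous set of
    order type [mu] whose supremum lies in the club ([homogeneous_limit]), and
    this set is a candidate ladder, named by a set of traces. So a guess at [d],
    that is, a set of traces and a colour, is one of a small set of guesses.

    Choosing one guess. By Engelking and Karlowicz there are functions
    [ek_fun i] from [Y] to guesses, with at most [K] many indices [i], that take
    any prescribed values on any small set of points ([engelking_karlowicz]). A
    point [y d] of [Y] therefore yields one ladder system with colours for each
    [i]; suppose that all of them fail, the [i]-th one for a function [F i] and a
    club. All values [F i s] together are coded by one ordinal below [kappa], and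
    on a club these codes are closed off. The set [bad d F] of points of [Y] all
    of whose guesses are wrong at [d] depends only on the codes over candidate
    points of [d], hence takes at most [aleph k] values as long as these codes are
    below [d]; so [y d] can be chosen in advance outside all the bad sets that are
    small ([avoid_bad]). As every guess of [y d] is wrong, [bad d F] is then large
    for all [d] of cofinality [mu] in the intersection of the clubs.

    The contradiction ([some_bad_small]). Take such a sequence [x] in that
    intersection and pick distinct bad points, one for each position [t] and each
    guess; some single [i] attaches to all of them the guess they were picked for.
    But [F i] has a homogeneous set with supremum some [x t], so at this position
    one of the guesses is correct for [F i]. The functions [F i] need not be
    homogeneous at the same position: having them wrong along a whole
    sequence in the club, rather than at one point, is what makes the argument work. *)

Import Order.TTheory.
Local Open Scope card_scope.

(** * Comparing cardinalities through functions *)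

Lemma card_le_of T U (A : set T) (B : set U) (f : T -> U) :
  (forall x, A x -> B (f x)) ->
  (forall x y, A x -> A y -> f x = f y -> x = y) -> A #<= B.
Proof.
move=> fAB finj; have := @inj_card_eq _ _ A f.
have inj : {in A &, injective f} by move=> x y /set_mem Ax /set_mem Ay; exact: finj.
move=> /(_ inj); rewrite card_eq_le => /andP[_ /card_le_trans]; apply => //.
by apply: subset_card_le => _ [x Ax <-]; exact: fAB.
Qed.

Lemma card_le_fun T U (A : set T) (B : set U) (u : U) : A #<= B ->
  exists f : T -> U, (forall x, A x -> B (f x)) /\
    (forall x y, A x -> A y -> f x = f y -> x = y).
Proof.
move=> /card_leP[g].
have gB (x : A) : B (set_val (g x)) by exact: set_valP.
have gi (x y : A) : g x = g y -> x = y.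
  by move=> e; apply: (@inj _ _ _ g) => //; exact: mem_setT.
exists (fun x => if pselect (A x) is left Ax then set_val (g (SigSub (mem_set Ax))) else u).
split=> [x Ax|x y Ax Ay]; first by case: pselect.
case: pselect => // Ax'; case: pselect => // Ay' /val_inj /gi.
by move=> [].
Qed.

Lemma card_leTP T U (u : U) :
  [set: T] #<= [set: U] <-> exists f : T -> U, injective f.
Proof.
split=> [/(card_le_fun u)[f [_ fi]]|[f fi]]; first by exists f => x y; exact: fi.
by apply: (@card_le_of _ _ _ _ f) => // x y _ _; exact: fi.
Qed.

Lemma card_le_surj T U (A : set T) (B : set U) (g : U -> T) :
  (forall x, A x -> exists2 u, B u & g u = x) -> A #<= B.
Proof.
move=> gAB; apply: card_le_trans (card_image_le g B).
by apply: subset_card_le => x /gAB[u Bu <-]; exists u.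
Qed.

Lemma card_le_setX T T' U U' (A : set T) (A' : set T') (B : set U) (B' : set U') :
  A #<= B -> A' #<= B' -> A `*` A' #<= B `*` B'.
Proof.
have [->|/set0P[a Aa]] := eqVneq A set0; first by rewrite set0X.
have [->|/set0P[a' Aa']] := eqVneq A' set0; first by rewrite setX0.
move=> AB AB'.
have [B0|/set0P[b Bb]] := eqVneq B set0.
  by move: AB; rewrite B0 => /card_le0P A0; move: Aa; rewrite A0.
have [B0|/set0P[b' Bb']] := eqVneq B' set0.
  by move: AB'; rewrite B0 => /card_le0P A0; move: Aa'; rewrite A0.
have [f [fA fi]] := card_le_fun b AB; have [g [gA gi]] := card_le_fun b' AB'.
apply: (@card_le_of _ _ _ _ (fun x => (f x.1, g x.2))) => [[x y] [/= Ax Ay]|].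
  by split; [exact: fA|exact: gA].
by move=> [x y] [x' y'] [/= Ax Ay] [/= Ax' Ay'] [/fi -> // /gi ->].
Qed.

(** Hilbert's hotel: a copy of [nat] inside [A] is shifted to make room. *)
Lemma card_le_setU1 T (A : set T) (x : T) : infinite_set A -> (x |` A) #<= A.
Proof.
have [Ax|nAx] := pselect (A x).
  by move=> _; apply: subset_card_le => y [->|].
move=> /infiniteP /(card_le_fun x)[g [gA gi]].
have gi' m n : g m = g n -> m = n by exact: gi.
pose f y := if pselect (y = x) then g 0%N
  else if pselect (exists n, y = g n) is left e then g (projT1 (cid e)).+1 else y.
have fE n : f (g n) = g n.+1.
  rewrite /f; case: (pselect (g n = x)) => [e|ne].
    by case: nAx; rewrite -e; exact: gA.
  case: (pselect (exists m, g n = g m)) => [e|[]]; last by exists n.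
  by congr (g _.+1); apply/esym/gi'; exact: projT2 (cid e).
have fx : f x = g 0%N by rewrite /f; case: (pselect (x = x)).
have fN y : A y -> (forall n, y <> g n) -> f y = y.
  move=> Ay yN; rewrite /f; case: (pselect (y = x)) => [e|ne].
    by case: nAx; rewrite -e.
  by case: (pselect (exists n, y = g n)) => [[n yn]|//]; case: (yN n).
have cases y : (x |` A) y -> [\/ y = x, exists n, y = g n | A y /\ forall n, y <> g n].
  case=> [->|Ay]; first exact: Or31.
  have [[n yn]|yN] := pselect (exists n, y = g n); first by apply: Or32; exists n.
  by apply: Or33; split => // n yn; apply: yN; exists n.
apply: (@card_le_of _ _ _ _ f) => [y /cases[->|[n ->]|[Ay /fN -> //]]|y z].
- by rewrite fx; exact: gA.
- by rewrite fE; exact: gA.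
move=> /cases[->|[n ->]|[Ay yN]] /cases[->|[m ->]|[Az zN]] //;
  rewrite ?fx ?fE ?(fN _ Ay yN) ?(fN _ Az zN) //.
- by move/gi'.
- by move=> e; case: (zN 0%N).
- by move/gi'.
- by move/gi' => [->].
- by move=> e; case: (zN n.+1).
- by move=> e; case: (yN 0%N).
- by move=> e; case: (yN m.+1).
Qed.

(** * Ordinals as well-ordered types *)

(** Types built from [Ord] itself are too large to carry a [wellOrder]; counting
    arguments go through the carrier of [repr a] instead. *)
Lemma wo_enum (a : Ord) : exists h : repr a -> Ord,
  [/\ forall x y, wo_lt x y -> (h x < h y)%O, injective h & range h = below a].
Proof.
have [h [hm hi hr]] := below_wo (repr a); exists h; split => //.
by rewrite hr /ord_of reprK.
Qed.

Lemma below_repr (a : Ord) : below a #= [set: repr a].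
Proof. by have := below_card (repr a); rewrite /ord_of reprK. Qed.

Lemma wo_enum_lt (w : wellOrder) (h : w -> Ord) :
  (forall x y, wo_lt x y -> (h x < h y)%O) ->
  forall x y, (h x < h y)%O -> wo_lt x y.
Proof.
move=> hm x y hxy; case: (wo_total x y) => // [xy|/hm yx].
  by move: hxy; rewrite xy ltxx.
by move: (lt_trans hxy yx); rewrite ltxx.
Qed.

Lemma least_in (S : set Ord) : S !=set0 -> S (least S).
Proof. by move=> /leastP[]. Qed.

Lemma least_le (S : set Ord) a : S a -> (least S <= a)%O.
Proof. by move=> Sa; have [|_] := @leastP S; [exists a|apply]. Qed.

Lemma ord0_le a : (Defs.ord0 <= a)%O.
Proof.
rewrite leNgt; apply/negP => /lt_ord_of[x _]; exact: (match x with end).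
Qed.

Lemma small_card T : exists a, [/\ is_cardinal a, [set: T] #<= below a & below a #<= [set: T]].
Proof.
have [a [ac]] := card_exists T; rewrite card_eq_le => /andP[aT Ta].
by exists a.
Qed.

Lemma cardinal_lt a b : is_cardinal a -> (b < a)%O -> ~ (below a #<= below b).
Proof.
move=> ac ba ab; have := ac b ba; rewrite card_eq_le ab andbT.
by rewrite below_subset // ltW.
Qed.

Lemma cardinal_le_of a b : is_cardinal a -> below a #<= below b -> (a <= b)%O.
Proof. by move=> ac ab; rewrite leNgt; apply/negP => /(cardinal_lt ac). Qed.

Lemma ord_card a : exists c, [/\ is_cardinal c, (c <= a)%O, below c #<= below a
  & below a #<= below c].
Proof.
have [c [cc ca ac]] := small_card (repr a).
have := below_repr a; rewrite card_eq_le => /andP[h1 h2].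
have ca' := card_le_trans ac h2; exists c; split=> //; last exact: card_le_trans ca.
exact: cardinal_le_of.
Qed.

Lemma enum_inv (a : Ord) : (Defs.ord0 < a)%O -> exists (h : repr a -> Ord) (k : Ord -> repr a),
  [/\ injective h, forall i, (h i < a)%O, cancel h k &
      forall x, (x < a)%O -> h (k x) = x].
Proof.
have [h [_ hi hr]] := wo_enum a => a0.
have ha i : (h i < a)%O by have : range h (h i) by [exists i]; rewrite hr.
have : range h Defs.ord0 by rewrite hr.
move=> [i0 _ _].
have /choice[k kP] x : exists i, (x < a)%O -> h i = x.
  have [xa|nx] := pselect ((x < a)%O); last by exists i0.
  have : range h x by rewrite hr.
  by move=> [i _ <-]; exists i.
by exists h, k; split => // i; apply: hi; apply: kP.
Qed.

Lemma ord0_lt_infinite a : infinite_cardinal a -> (Defs.ord0 < a)%O.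
Proof.
move=> [_ ai]; rewrite lt_neqAle ord0_le andbT; apply/negP => /eqP a0; apply: ai.
suff -> : below a = set0 by exact: finite_set0.
by apply/seteqP; split => // x; rewrite -a0 /below /= ltNge ord0_le.
Qed.

(** * Hessenberg's theorem *)

Section goedel.
Variable w : wellOrder.

Let mx (p : w * w) : w := if pselect (wo_lt p.1 p.2) then p.2 else p.1.

Let lt (p q : w * w) : Prop := wo_lt (mx p) (mx q) \/
  mx p = mx q /\ (wo_lt p.1 q.1 \/ p.1 = q.1 /\ wo_lt p.2 q.2).

Let lt_wf : well_founded lt.
Proof.
move=> p; have [m mE] : exists m, m = mx p by exists (mx p).
elim/(well_founded_ind (@wo_wf w)): m p mE => m IHm [x y].
elim/(well_founded_ind (@wo_wf w)): x y => x IHx y.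
elim/(well_founded_ind (@wo_wf w)): y => y IHy mE.
constructor=> -[x' y'] [|[+ [/= x'x|[/= x'x y'y]]]].
- by move=> h; apply: (IHm (mx (x', y'))) => //; rewrite mE.
- by move=> h; apply: (IHx x' x'x y'); rewrite h mE.
- by subst x' => h; apply: (IHy y' y'y); rewrite h mE.
Qed.

Let lt_trans p q r : lt p q -> lt q r -> lt p r.
Proof.
move=> [pq|[pq pq']] [qr|[qr qr']].
- by left; exact: wo_trans qr.
- by left; rewrite -qr.
- by left; rewrite pq.
right; split; first by rewrite pq.
case: pq' qr' => [pq'|[pq' pq'']] [qr'|[qr' qr'']].
- by left; exact: wo_trans qr'.
- by left; rewrite -qr'.
- by left; rewrite pq'.
- by right; split; [rewrite pq'|exact: wo_trans qr''].
Qed.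

Let lt_total p q : [\/ lt p q, p = q | lt q p].
Proof.
case: (wo_total (mx p) (mx q)) => mpq; [by constructor 1; left| |by constructor 3; left].
case: (wo_total p.1 q.1) => pq1; [by constructor 1; right; split; tauto| |].
  case: (wo_total p.2 q.2) => pq2.
  - by constructor 1; right; split; tauto.
  - by constructor 2; case: p q pq1 pq2 {mpq} => ? ? [? ?] /= -> ->.
  - by constructor 3; right; split => //; right.
by constructor 3; right; split; [rewrite mpq|left].
Qed.

(** Pairs are compared by their maximum first, so that a proper initial
    segment lies in the square of a proper initial segment. *)
Definition goedel : wellOrder := WellOrder lt_wf lt_trans lt_total.

Lemma goedel_seg (p : goedel) : exists m : w, forall q : goedel, wo_lt q p ->
  (q.1 = m \/ wo_lt q.1 m) /\ (q.2 = m \/ wo_lt q.2 m).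
Proof.
exists (mx p) => q qp.
suff [h1 h2] : (q.1 = mx q \/ wo_lt q.1 (mx q)) /\ (q.2 = mx q \/ wo_lt q.2 (mx q)).
  case: qp => [qp|[<- _]] //; split.
    by right; case: h1 => [->|/wo_trans]; [|exact].
  by right; case: h2 => [->|/wo_trans]; [|exact].
rewrite /mx; case: pselect => h /=; split; [by right|by left|by left|].
by case: (wo_total q.1 q.2) => // [->|]; [left|right].
Qed.

End goedel.

Theorem hessenberg a : infinite_cardinal a -> below a `*` below a #<= below a.
Proof.
elim/(well_founded_ind Ord_lt_wf): a => a IH [ac ai].
have := below_repr a; rewrite card_eq_le => /andP[a1 a2].
have aE : ord_of (repr a) = a by exact: reprK.
suff h : [set: repr a * repr a] #<= below a.
  apply: card_le_trans h; rewrite -setXTT; exact: card_le_setX.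
have := below_card (goedel (repr a)); rewrite card_eq_le => /andP[_ /card_le_trans].
apply; apply: below_subset; rewrite leNgt; apply/negP => /lt_ord_of[p pE].
have [m hm] := goedel_seg p.
pose b := ord_of (wo_seg m).
have ba : (b < a)%O by rewrite -aE; apply/lt_ord_of; exists m.
pose A := [set x : repr a | x = m \/ wo_lt x m].
have sA : below a #<= A `*` A.
  have := below_card (wo_seg p); rewrite -pE card_eq_le => /andP[/card_le_trans + _]; apply.
  apply: (@card_le_of _ _ _ _ (fun q => sval q)) => [[q qp] _|]; first exact: hm.
  by move=> [q qp] [q' qp'] _ _ /= e; apply: eq_exist.
have Ab : [set x | wo_lt x m] #<= below b.
  have := below_card (wo_seg m); rewrite -/b card_eq_le => /andP[_].
  apply: card_le_trans.
  apply: (@card_le_surj _ _ _ _ (fun q : wo_seg m => sval q)) => x xm.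
  by exists (exist _ x xm).
have AE : A = m |` [set x | wo_lt x m] by apply/seteqP; split => x.
have [fin|inf] := pselect (finite_set [set x | wo_lt x m]).
  apply: ai; apply: card_le_finite sA _; apply: finite_setX;
  by rewrite AE finite_setU.
have [c [cc cb h1 h2]] := ord_card b.
have ca : (c < a)%O by exact: le_lt_trans cb ba.
have Ac : A #<= below c.
  rewrite AE; apply: card_le_trans (card_le_setU1 m inf) _.
  exact: card_le_trans Ab h2.
apply: (@cardinal_lt a c) => //; apply: card_le_trans sA _.
apply: card_le_trans (card_le_setX Ac Ac) _; apply: IH => //; split=> //.
move=> fc; apply: inf; apply: card_le_finite (card_le_trans Ab h2) fc.
Qed.

(** * The alephs *)

Lemma aleph_lt1 n : (aleph n < aleph n.+1)%O.
Proof. exact: (alephSP n).2. Qed.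

Lemma aleph_homo m n : (m <= n)%N -> (aleph m <= aleph n)%O.
Proof.
elim: n => [|n IH]; first by rewrite leqn0 => /eqP ->.
rewrite leq_eqVlt => /orP[/eqP -> //|/IH /le_trans]; apply; exact/ltW/aleph_lt1.
Qed.

Lemma aleph_inf n : infinite_cardinal (aleph n).
Proof.
have [c0 i0] := aleph0P.1; case: n => [|n] //; split; first exact: (alephSP n).1.
by move=> /(card_le_finite (below_subset (aleph_homo (leq0n n.+1)))).
Qed.

Lemma below_alephS b n : (b < aleph n.+1)%O -> below b #<= below (aleph n).
Proof.
have [c [cc cb _ bc]] := ord_card b => bn; apply: card_le_trans bc _.
apply: below_subset; rewrite leNgt; apply/negP => nc.
suff : (aleph n.+1 <= b)%O by rewrite leNgt bn.
by apply: le_trans cb; apply: least_le.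
Qed.

Lemma lt_aleph_omega a : (a < aleph_omega)%O -> exists n, (a < aleph n)%O.
Proof.
have [ub lb] := aleph_omegaP => aw; apply: contrapT => na.
suff : (aleph_omega <= a)%O by rewrite leNgt aw.
by apply: lb => _ [n _ <-]; rewrite leNgt; apply/negP => an; apply: na; exists n.
Qed.

Lemma aleph_lt_omega n : (aleph n < aleph_omega)%O.
Proof.
by apply: lt_le_trans (aleph_lt1 n) _; apply: aleph_omegaP.1; exists n.+1.
Qed.

Lemma is_aleph a : infinite_cardinal a -> (a < aleph_omega)%O ->
  exists n, a = aleph n.
Proof.
move=> ai /lt_aleph_omega[n]; elim: n => [|n IH].
  by rewrite ltNge; rewrite (aleph0P.2 _ ai).
move=> an; case: (ltgtP a (aleph n)) => [/IH //|na|->]; last by exists n.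
suff : (aleph n.+1 <= a)%O by rewrite leNgt an.
by apply: least_le; split=> //; case: ai.
Qed.

Lemma alephX n : below (aleph n) `*` below (aleph n) #<= below (aleph n).
Proof. exact: hessenberg (aleph_inf n). Qed.

Lemma card_le_bigcup I T (D : set I) (F : I -> set T) n :
  D #<= below (aleph n) -> (forall i, D i -> F i #<= below (aleph n)) ->
  \bigcup_(i in D) F i #<= below (aleph n).
Proof.
have [->|/set0P[i0 _]] := eqVneq D set0; first by rewrite bigcup_set0.
move=> /(card_le_fun Defs.ord0)[d [dB di]] FB.
have /choice[g gP] i : exists g : T -> Ord, D i ->
    (forall x, F i x -> below (aleph n) (g x)) /\
    (forall x y, F i x -> F i y -> g x = g y -> x = y).
  have [/FB/(card_le_fun Defs.ord0)[g gP]|nD] := pselect (D i); first by exists g.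
  by exists (fun=> Defs.ord0).
have /choice[s sP] x : exists i, (\bigcup_(i in D) F i) x -> D i /\ F i x.
  have [[i Di Fi]|nx] := pselect ((\bigcup_(i in D) F i) x); first by exists i.
  by exists i0.
apply: card_le_trans (alephX n).
apply: (@card_le_of _ _ _ _ (fun x => (d (s x), g (s x) x))) => [x /sP[Ds Fs]|x y].
  by split; [exact: dB|exact: (gP _ Ds).1].
move=> /sP[Dx Fx] /sP[Dy Fy] [/di e]; move: (e Dx Dy) => {}e.
by move: Fx; rewrite e => Fx; exact: (gP _ Dy).2.
Qed.

(** A finite union of finite sets is finite, and a union of [aleph n] sets of
    size [aleph n] has size [aleph n]: so every [aleph n] is regular. *)
Lemma aleph_bounded I (D : set I) (F : I -> Ord) n b :
  (b < aleph n)%O -> D #<= below b -> (forall i, D i -> (F i < aleph n)%O) ->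
  exists2 c, (c < aleph n)%O & forall i, D i -> (F i < c)%O.
Proof.
move=> bn Db Fn; apply: contrapT => nb.
have cover : below (aleph n) `<=` \bigcup_(i in D) (F i |` below (F i)).
  move=> c cn; apply: contrapT => nc; apply: nb; exists c => // i Di.
  rewrite ltNge; apply/negP => cF; apply: nc; exists i => //.
  by move: cF; rewrite le_eqVlt => /orP[/eqP ->|]; [left|right].
case: n bn Fn nb cover => [|n] bn Fn nb cover.
  have fb c : (c < aleph 0)%O -> finite_set (below c).
    move=> c0; apply: contrapT => ci; have [d [dc dc' h1 h2]] := ord_card c.
    have : (aleph 0 <= d)%O.
      by apply: aleph0P.2; split=> // fd; apply: ci; exact: card_le_finite h2 fd.
    by rewrite leNgt => /negP; apply; exact: le_lt_trans c0.
  apply: (aleph_inf 0).2; apply: sub_finite_set cover _; apply: bigcup_finite.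
    exact: card_le_finite Db (fb _ bn).
  by move=> i Di; rewrite finite_setU; split; [exact: finite_set1|exact/fb/Fn].
have : below (aleph n.+1) #<= below (aleph n).
  apply: card_le_trans (subset_card_le cover) _; apply: card_le_bigcup.
    exact: card_le_trans Db (below_alephS bn).
  move=> i /Fn/below_alephS Fi.
  have [fin|inf] := pselect (finite_set (below (F i))).
    have : finite_set (F i |` below (F i)) by rewrite finite_setU.
    move=> /finite_set_leP[k /card_le_trans]; apply.
    apply: card_le_trans (card_leT _) _; apply/infiniteP; exact: (aleph_inf n).2.
  exact: card_le_trans (card_le_setU1 _ inf) Fi.
exact: cardinal_lt (alephSP n).1 (aleph_lt1 n).
Qed.

Lemma aleph_succ n x : (x < aleph n)%O -> exists2 y, (y < aleph n)%O & (x < y)%O.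
Proof.
move=> xn; apply: contrapT => ny.
have sub : below (aleph n) `<=` x |` below x.
  move=> y yn; case: (ltgtP y x) => [yx|xy|->]; [by right| |by left].
  by case: ny; exists y.
have [fin|inf] := pselect (finite_set (below x)).
  by apply: (aleph_inf n).2; apply: sub_finite_set sub _; rewrite finite_setU.
apply: (cardinal_lt (aleph_inf n).1 xn).
exact: card_le_trans (subset_card_le sub) (card_le_setU1 _ inf).
Qed.

(** * Types of size less than [aleph_omega] *)

Definition small (T : Type) := exists n, [set: T] #<= below (aleph n).

Lemma small_inj T U (f : T -> U) : injective f -> small U -> small T.
Proof.
move=> fi [n Un]; exists n; apply: card_le_trans Un.
by apply: (@card_le_of _ _ _ _ f) => // x y _ _; exact: fi.
Qed.

Lemma small_nat : small nat.
Proof. by exists 0%N; apply/infiniteP; exact: (aleph_inf 0).2. Qed.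

Lemma small_repr a : (a < aleph_omega)%O -> small (repr a).
Proof.
move=> /lt_aleph_omega[n an]; exists n.
have := below_repr a; rewrite card_eq_le => /andP[_ /card_le_trans]; apply.
exact/below_subset/ltW.
Qed.

Lemma small_prod T U : small T -> small U -> small (T * U).
Proof.
move=> [m Tm] [n Un]; exists (maxn m n).
apply: card_le_trans (alephX _); rewrite -setXTT; apply: card_le_setX.
  by apply: card_le_trans Tm _; apply/below_subset/aleph_homo/leq_maxl.
by apply: card_le_trans Un _; apply/below_subset/aleph_homo/leq_maxr.
Qed.

Lemma small_option T : small T -> small (option T).
Proof.
move=> [n Tn]; exists n; apply: card_le_trans (card_le_setU1 (aleph n) (aleph_inf n).2).
have [f [fB fi]] := card_le_fun Defs.ord0 Tn.
apply: (@card_le_of _ _ _ _ (fun o => if o is Some x then f x else aleph n)).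
  by move=> [x _|_]; [right; exact: fB|left].
move=> [x|] [y|] _ _ // => [/(fi _ _ I I) -> //|e|e].
  by have := fB x I; rewrite /below /= e ltxx.
by have := fB y I; rewrite /below /= -e ltxx.
Qed.

Lemma small_sum T U : small T -> small U -> small (T + U).
Proof.
move=> /small_option sT /small_option sU; pose f (z : T + U) :=
  match z with inl x => (Some x, None) | inr y => (None, Some y) end.
apply: (@small_inj _ _ f) (small_prod sT sU).
by move=> [x|x] [y|y] //= [->].
Qed.

Section strong_limit.
Hypothesis sl : strong_limit aleph_omega.

Lemma small_pow T : small T -> small (T -> Prop).
Proof.
move=> [n Tn]; have [c [cc ct tc]] := small_card (T -> Prop).
have [cw|wc] := ltP c aleph_omega.
  have [m cm] := lt_aleph_omega cw; exists m; apply: card_le_trans ct _.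
  exact/below_subset/ltW.
have [f [fB fi]] := card_le_fun Defs.ord0 Tn.
exfalso; apply: (sl.2 (aleph n) (aleph_inf n).1 (aleph_lt_omega n)).
apply: card_le_trans (below_subset wc) _; apply: card_le_trans tc _.
apply: (@card_le_of _ _ _ _ (fun X => f @` X)).
  by move=> X _ _ [x _ <-]; exact: fB.
move=> X Y _ _ XY; apply/seteqP; split => x Xx.
  by have : (f @` X) (f x) by [exists x]; rewrite XY => -[y Yy /(fi _ _ I I) <-].
by have : (f @` Y) (f x) by [exists x]; rewrite -XY => -[y Yy /(fi _ _ I I) <-].
Qed.

Lemma small_fun T U : small T -> small U -> small (T -> U).
Proof.
move=> sT sU; apply: (@small_inj _ _ (fun f z => f z.1 = z.2)) (small_pow (small_prod sT sU)).
move=> f g e; apply/funext => x; move: (congr1 (fun P => P (x, f x)) e) => /= E.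
by apply/esym; rewrite -E.
Qed.

Lemma small_seq T : small T -> small (seq T).
Proof.
move=> sT; apply: (@small_inj _ _ (@onth T)) (small_fun small_nat (small_option sT)).
elim=> [|x s IH] [|y t] e //; try by move: (congr1 (fun h => h 0%N) e).
move: (congr1 (fun h => h 0%N) e) => [->]; congr cons; apply: IH.
by apply/funext => k; move: (congr1 (fun h => h k.+1) e).
Qed.

End strong_limit.

(** * Order types and cofinalities *)

Definition mono_on (a : Ord) (h : Ord -> Ord) :=
  forall x y, (x < a)%O -> (y < a)%O -> (x < y)%O -> (h x < h y)%O.

Lemma mono_on_ge a h : mono_on a h -> forall x, (x < a)%O -> (x <= h x)%O.
Proof.
move=> hm; elim/(well_founded_ind Ord_lt_wf) => x IH xa.
rewrite leNgt; apply/negP => hx.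
have hxa := lt_trans hx xa.
have := IH _ hx hxa; rewrite leNgt => /negP; apply; exact: hm.
Qed.

Lemma mono_on_inj a h : mono_on a h ->
  forall x y, (x < a)%O -> (y < a)%O -> h x = h y -> x = y.
Proof.
move=> hm x y xa ya e; case: (ltgtP x y) => // xy.
  by have := hm _ _ xa ya xy; rewrite e ltxx.
by have := hm _ _ ya xa xy; rewrite e ltxx.
Qed.

Lemma mono_on_lt a h : mono_on a h ->
  forall x y, (x < a)%O -> (y < a)%O -> (h x < h y)%O -> (x < y)%O.
Proof.
move=> hm x y xa ya hxy; rewrite ltNge le_eqVlt; apply/negP => /orP[/eqP e|yx].
  by move: hxy; rewrite e ltxx.
by have := hm _ _ ya xa yx; rewrite ltNge (ltW hxy).
Qed.

Lemma otp_image a h : mono_on a h -> otp (h @` below a) = a.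
Proof.
move=> hm.
have le b c (h1 h2 : Ord -> Ord) : mono_on b h1 -> mono_on c h2 ->
    h1 @` below b `<=` h2 @` below c -> (b <= c)%O.
  move=> m1 m2 sub.
  have /choice[k kP] x : exists y, (x < b)%O -> (y < c)%O /\ h2 y = h1 x.
    have [xb|nx] := pselect ((x < b)%O); last by exists x.
    by have [|y yc e] := sub (h1 x); [exists x|exists y].
  rewrite leNgt; apply/negP => cb.
  have km : mono_on b k.
    move=> x y xb yb xy; have [kx ex] := kP _ xb; have [ky ey] := kP _ yb.
    by apply: (mono_on_lt m2) => //; rewrite ex ey; exact: m1.
  have := mono_on_ge km cb; rewrite leNgt => /negP; apply.
  exact: (kP _ cb).1.
have bijE b h' : set_bij (below b) (h @` below a) h' -> h' @` below b = h @` below a.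
  move=> [fu _ su]; apply/seteqP; split=> [_ [x xb <-]|z /su //]; exact: fu.
have [h' hb h'm] : exists2 h' : Ord -> Ord,
    set_bij (below (otp (h @` below a))) (h @` below a) h' &
    forall x y, below (otp (h @` below a)) x -> below (otp (h @` below a)) y ->
      (x < y)%O -> (h' x < h' y)%O.
  apply: (@xgetPex _ _ [set b | exists2 h' : Ord -> Ord,
    set_bij (below b) (h @` below a) h' &
    forall x y, below b x -> below b y -> (x < y)%O -> (h' x < h' y)%O]).
  exists a, h => //; split=> [x xa|x y /set_mem xa /set_mem ya|z //].
    by exists x.
  exact: (mono_on_inj hm).
have h'E := bijE _ _ hb.
apply/eqP; rewrite eq_le; apply/andP; split.
  by apply: (@le _ _ h' h) => //; rewrite h'E.
by apply: (@le _ _ h h') => //; rewrite h'E.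
Qed.

Lemma otp_enum a (X : set Ord) : X `<=` below a ->
  exists2 h, mono_on (otp X) h & X = h @` below (otp X).
Proof.
move=> /otpP[h [fu _ su] hm]; exists h => //.
by apply/seteqP; split=> [z /su //|_ [x xb <-]]; exact: fu.
Qed.

Lemma card_otp a (X : set Ord) : X `<=` below a ->
  X #<= below (otp X) /\ below (otp X) #<= X.
Proof.
move=> /otp_enum[h hm XE]; split.
  apply: (@card_le_surj _ _ _ _ h) => x; rewrite {1}XE => -[y yb <-].
  by exists y.
apply: (@card_le_of _ _ _ _ h) => [x xb|x y]; first by rewrite XE; exists x.
exact: (mono_on_inj hm).
Qed.

Lemma otp_sub a (X : set Ord) n : X `<=` below a -> below (aleph n) #<= X ->
  exists2 h, mono_on (aleph n) h & forall x, (x < aleph n)%O -> X (h x).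
Proof.
move=> Xa nX; have [h hm XE] := otp_enum Xa; have [Xo oX] := card_otp Xa.
have no : (aleph n <= otp X)%O.
  by apply: (cardinal_le_of (aleph_inf n).1); exact: card_le_trans Xo.
exists h => [x y xn yn xy|x xn].
  by apply: hm => //; exact: lt_le_trans no.
by rewrite XE; exists x => //; exact: lt_le_trans no.
Qed.

Lemma cofinal_otp_cf d : exists2 X, cofinal_in d X & otp X = cf d.
Proof.
have [|[X Xd Xc] _] := @leastP [set otp X | X in cofinal_in d]; last by exists X.
exists (otp (below d)), (below d) => //; split => // x xd; by exists x.
Qed.

Lemma cofinal_range n h d : mono_on (aleph n) h ->
  (forall x, (x < aleph n)%O -> (h x < d)%O) ->
  (forall y, (y < d)%O -> exists2 x, (x < aleph n)%O & (y <= h x)%O) ->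
  cofinal_in d (h @` below (aleph n)) /\ cf d = aleph n.
Proof.
move=> hm hd hc.
have co : cofinal_in d (h @` below (aleph n)).
  split=> [_ [x xn <-]|y /hc[x xn yx]]; first exact: hd.
  by exists (h x) => //; exists x.
split=> //; apply/eqP; rewrite eq_le; apply/andP; split.
  by apply: least_le; exists (h @` below (aleph n)) => //; exact: otp_image.
have [X [Xd Xc] <-] := cofinal_otp_cf d.
rewrite leNgt; apply/negP => Xn.
have /choice[k kP] x : exists y, X x -> (y < aleph n)%O /\ (x <= h y)%O.
  have [/Xd/hc[y yn xy]|nx] := pselect (X x); first by exists y.
  by exists x.
have [|c cn kc] := @aleph_bounded _ X k n (otp X) Xn (card_otp Xd).1.
  by move=> i /kP[].
have [x Xx hcx] := Xc _ (hd _ cn); have [kn xk] := kP _ Xx.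
by have := hm _ _ kn cn (kc _ Xx); rewrite ltNge (le_trans hcx xk).
Qed.

Lemma cf_aleph n : cf (aleph n) = aleph n.
Proof.
have [||//|] := @cofinal_range n id (aleph n) => //.
by move=> y yn; exists y.
Qed.

(** * The Erdos-Rado theorem *)

Section end_homogeneous.
Variables (X : set Ord) (f : seq Ord -> Ord) (n : nat).

Definition chain (A : set Ord) (t : seq Ord) :=
  [/\ sorted <%O t, size t = n & forall z, z \in t -> A z].

Lemma chain_sub (A B : set Ord) t : A `<=` B -> chain A t -> chain B t.
Proof. by move=> AB [st nt tA]; split => // z /tA /AB. Qed.

(** The Erdos-Rado tree: [y] lies below [x] when it receives the same colours as
    [x] over the points that lie below both. The points below [x] then form an
    end-homogeneous set, which a new largest element does not spoil. As the
    clause for [y] mentions the clauses for smaller points, the relation is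
    defined by recursion on [y]. *)
Definition tree_step (x y : Ord) (rec : forall z, (z < y)%O -> Prop) : Prop :=
  [/\ X y, (y < x)%O & forall t, chain [set z | exists zy : (z < y)%O, rec z zy] t ->
        f (rcons t y) = f (rcons t x)].

Definition tree_lt (x : Ord) : Ord -> Prop :=
  Fix Ord_lt_wf (fun _ => Prop) (tree_step x).

Lemma tree_ltE x y : tree_lt x y =
  [/\ X y, (y < x)%O & forall t, chain [set z | (z < y)%O /\ tree_lt x z] t ->
        f (rcons t y) = f (rcons t x)].
Proof.
rewrite /tree_lt Fix_eq; last first.
  move=> z g g' gg'; congr (tree_step _ _).
  by apply: functional_extensionality_dep => u; apply/funext => zu.
rewrite -/(tree_lt x) /tree_step.
have -> // : [set z | exists _ : (z < y)%O, tree_lt x z] = [set z | (z < y)%O /\ tree_lt x z].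
by apply/seteqP; split => z [zy h]; [split|exists zy].
Qed.

Lemma tree_lt_lt x y : tree_lt x y -> (y < x)%O.
Proof. by rewrite tree_ltE => -[]. Qed.

Lemma tree_ltX x y : tree_lt x y -> X y.
Proof. by rewrite tree_ltE => -[]. Qed.

Lemma tree_lt_col x y t : tree_lt x y -> chain [set z | (z < y)%O /\ tree_lt x z] t ->
  f (rcons t y) = f (rcons t x).
Proof. by rewrite {1}tree_ltE => -[_ _]; apply. Qed.

(** Hence the predecessors of a point are linearly ordered by the tree. *)
Lemma tree_lt_restr x y z : tree_lt x y -> (z < y)%O -> tree_lt y z = tree_lt x z.
Proof.
move=> xy; have yx := tree_lt_lt xy.
elim/(well_founded_ind Ord_lt_wf): z => z IH zy.
have E : [set u | (u < z)%O /\ tree_lt y u] = [set u | (u < z)%O /\ tree_lt x u].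
  apply/seteqP; split => u [uz h]; split => //; move: h;
    by rewrite IH //; exact: lt_trans zy.
rewrite tree_ltE [in RHS]tree_ltE E; apply/propext; split=> -[Xz zz h]; split => //.
- exact: lt_trans zy yx.
- move=> t tz; rewrite h //; apply: tree_lt_col xy _; apply: chain_sub tz.
  by move=> u [uz ux]; split => //; exact: lt_trans zy.
- move=> t tz; rewrite h //; apply/esym/(tree_lt_col xy); apply: chain_sub tz.
  by move=> u [uz ux]; split => //; exact: lt_trans zy.
Qed.

Lemma tree_lt_set x y : tree_lt x y -> tree_lt y = [set z | (z < y)%O /\ tree_lt x z].
Proof.
move=> xy; apply/seteqP; split => z.
  by move=> yz; have zy := tree_lt_lt yz; split=> //; rewrite -(tree_lt_restr xy zy).
by move=> [zy]; rewrite (tree_lt_restr xy zy).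
Qed.

(** As the predecessors of [x] form a chain, the least value that they miss is the
    height of [x] in the tree. *)
Definition rank : Ord -> Ord :=
  Fix Ord_lt_wf (fun _ => Ord) (fun x rec =>
    least [set a | forall y (yx : (y < x)%O), tree_lt x y -> rec y yx <> a]).

Lemma rankE x : rank x = least [set a | forall y, tree_lt x y -> rank y <> a].
Proof.
rewrite {1}/rank Fix_eq; last first.
  move=> z g g' gg'; congr least; apply/seteqP; split=> a h y yz xy;
    [rewrite -gg'|rewrite gg']; exact: h.
rewrite -/rank; congr least; apply/seteqP; split=> a h y.
  by move=> xy; exact: h (tree_lt_lt xy) xy.
by move=> yx; exact: h.
Qed.

Lemma rank_le x : (rank x <= x)%O /\ forall y, tree_lt x y -> rank y <> rank x.
Proof.
elim/(well_founded_ind Ord_lt_wf): x => x IH.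
have xin y : tree_lt x y -> rank y <> x.
  move=> xy e; have yx := tree_lt_lt xy; have [] := IH _ yx.
  by rewrite e leNgt yx.
rewrite rankE; split; first exact: least_le.
by apply: (@least_in [set a | forall y, tree_lt x y -> rank y <> a]); exists x.
Qed.

Lemma rank_onto x a : (a < rank x)%O -> exists2 y, tree_lt x y & rank y = a.
Proof.
move=> ax; apply: contrapT => na.
have : (rank x <= a)%O.
  by rewrite rankE; apply: least_le => y xy ya; apply: na; exists y.
by rewrite leNgt ax.
Qed.

Lemma rank_lt x y : tree_lt x y -> (rank y < rank x)%O.
Proof.
move=> xy; have yx := (rank_le x).2 y xy.
case: (ltgtP (rank y) (rank x)) yx => // xry _.
have [z yz zx] := rank_onto xry; case: ((rank_le x).2 z) => //.
by move: yz; rewrite (tree_lt_set xy) => -[].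
Qed.

Lemma rank_inj x y z : tree_lt x y -> tree_lt x z -> rank y = rank z -> y = z.
Proof.
move=> xy xz e; case: (ltgtP y z) => // h.
  have : tree_lt z y by rewrite (tree_lt_set xz).
  by move/rank_lt; rewrite e ltxx.
have : tree_lt y z by rewrite (tree_lt_set xy).
by move/rank_lt; rewrite e ltxx.
Qed.

Lemma map_rank_inj x t t' : chain (tree_lt x) t -> chain (tree_lt x) t' ->
  map rank t = map rank t' -> t = t'.
Proof.
move=> [_ _ tx] [_ _ tx']; elim: t t' tx tx' => [|y t IH] [|y' t'] //= tx tx' [e e'].
congr cons; first by apply: (@rank_inj x) => //; [apply: tx|apply: tx']; rewrite mem_head.
by apply: IH => // z zt; [apply: tx|apply: tx']; rewrite inE zt orbT.
Qed.

Definition same_type x x' := forall t t', chain (tree_lt x) t ->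
  chain (tree_lt x') t' -> map rank t = map rank t' ->
  f (rcons t x) = f (rcons t' x').

Lemma same_type_sym x x' : same_type x x' -> same_type x' x.
Proof. by move=> h t t' tx tx' e; rewrite (h t' t). Qed.

(** Two points with the same predecessors and the same colours over them are
    equal, since the smaller would be a predecessor of the larger; with the
    rank as a coordinate, the colours over the predecessors determine these. *)
Lemma same_type_eq x x' : X x -> X x' -> rank x = rank x' -> same_type x x' -> x = x'.
Proof.
move=> + + e; have [a aE] : exists a, a = rank x by exists (rank x).
elim/(well_founded_ind Ord_lt_wf): a x x' aE e => a IH x x' aE e Xx Xx' st.
have sub u u' : rank u = a -> rank u' = a -> same_type u u' ->
    X u -> X u' -> tree_lt u `<=` tree_lt u'.
  move=> ua ua' uu' Xu Xu' y uy.
  have [|y' uy' ye] := @rank_onto u' (rank y); first by rewrite ua' -ua; exact: rank_lt.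
  suff -> : y = y' by [].
  apply: (IH (rank y)) => //; [by rewrite -ua; exact: rank_lt|exact: tree_ltX uy|
    exact: tree_ltX uy'|].
  move=> t t'; rewrite (tree_lt_set uy) (tree_lt_set uy') => ty ty' tt'.
  rewrite (tree_lt_col uy ty) (tree_lt_col uy' ty'); apply: uu' => //.
    by apply: chain_sub ty => z [].
  by apply: chain_sub ty' => z [].
have E : tree_lt x = tree_lt x'.
  apply/seteqP; split; apply: sub => //; rewrite -?e //; exact: same_type_sym.
case: (ltgtP x x') => // h.
  have : tree_lt x' x.
    rewrite tree_ltE; split => // t; rewrite -E => tx.
    have tx' : chain (tree_lt x) t by apply: chain_sub tx => z [].
    by apply: st => //; rewrite -E.
  by rewrite -E => /tree_lt_lt; rewrite ltxx.
have : tree_lt x x'.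
  rewrite tree_ltE; split => // t; rewrite E => tx.
  have tx' : chain (tree_lt x') t by apply: chain_sub tx => z [].
  by apply/esym/st => //; rewrite E.
by rewrite E => /tree_lt_lt; rewrite ltxx.
Qed.

End end_homogeneous.

Lemma chain_rcons n (A : set Ord) s x : chain n A s ->
  (forall z, z \in s -> (z < x)%O) -> A x -> chain n.+1 A (rcons s x).
Proof.
move=> [ss sn sA] sx Ax; split; last 1 first.
- by move=> z; rewrite mem_rcons inE => /orP[/eqP ->|/sA].
- rewrite (sorted_pairwise lt_trans) pairwise_rcons -(sorted_pairwise lt_trans) ss andbT.
  by apply/allP => z /sx.
- by rewrite size_rcons sn.
Qed.

Lemma chainS n (A : set Ord) s : chain n.+1 A s ->
  exists t y, [/\ s = rcons t y, A y & chain n [set z | (z < y)%O /\ A z] t].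
Proof.
case/lastP: s => [|t y] [ss st sA] //; exists t, y.
have Ay : A y by apply: sA; rewrite mem_rcons mem_head.
move: ss; rewrite (sorted_pairwise lt_trans) pairwise_rcons -(sorted_pairwise lt_trans).
move=> /andP[/allP ty ts]; split => //; split => //.
  by move: st; rewrite size_rcons => -[].
by move=> z zt; split; [exact: ty|apply: sA; rewrite mem_rcons inE zt orbT].
Qed.

(** The partition relation [aleph l --> (aleph m)^n_theta]. *)
Definition arrow theta n l m := forall (X : set Ord) (f : seq Ord -> Ord),
  below (aleph l) #<= X -> (forall s, chain n X s -> (f s < theta)%O) ->
  exists A, [/\ A `<=` X, below (aleph m) #<= A &
    exists c, forall s, chain n A s -> f s = c].

Section erdos_rado.
Hypothesis sl : strong_limit aleph_omega.

(** By induction on [n]. If some point has [aleph l] many predecessors in the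
    tree, these are end-homogeneous and the induction hypothesis applies to the
    colours over that point. Otherwise all ranks are below [aleph l], and a point
    is determined by its rank and the colours over the ranks of its predecessors
    ([same_type_eq]), which bounds the size of [X]. *)
Lemma erdos_rado theta n m : infinite_cardinal theta -> (theta < aleph_omega)%O ->
  exists l, arrow theta n l m.
Proof.
move=> ti tw; elim: n m => [|n IH] m.
  exists m => X f mX _; exists X; split=> //; exists (f [::]) => s [_ + _].
  by move/size0nil ->.
have [l IHl] := IH m.
pose T := ((seq (repr (aleph l)) * repr theta -> Prop) * repr (aleph l))%type.
have [k Tk] : small T.
  have sl' : small (repr (aleph l)) := small_repr (aleph_lt_omega l).
  apply: small_prod => //; apply: (small_pow sl); apply: small_prod.
    exact: small_seq.
  exact: small_repr.
exists k.+1 => X f kX fX.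
have sub x : tree_lt X f n x `<=` X by move=> y; exact: tree_ltX.
have tree_lt_X x t : X x -> chain n (tree_lt X f n x) t -> (f (rcons t x) < theta)%O.
  move=> Xx tx; apply: fX; apply: chain_rcons => //; first exact: chain_sub tx.
  by case: tx => _ _ tx z /tx /tree_lt_lt.
have [[x Xx lx]|nx] := pselect (exists2 x, X x & (aleph l <= rank X f n x)%O).
  have [||A [AY mA [c cA]]] := IHl (tree_lt X f n x) (fun t => f (rcons t x)).
  - apply: (@card_le_surj _ _ _ _ (rank X f n)) => a al.
    by have [y xy <-] := rank_onto (lt_le_trans al lx); exists y.
  - by move=> s; exact: tree_lt_X.
  exists A; split=> //; first by move=> y /AY /sub.
  exists c => s /chainS[t [y [-> Ay ty]]]; rewrite -(cA t).
    apply: (tree_lt_col (AY _ Ay)); apply: chain_sub ty => z [zy /AY] //.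
  by apply: chain_sub ty => z [].
exfalso; have rl x : X x -> (rank X f n x < aleph l)%O.
  by move=> Xx; rewrite ltNge; apply/negP => lx; apply: nx; exists x.
have [hl [kl [_ _ _ klK]]] := enum_inv (ord0_lt_infinite (aleph_inf l)).
have [ht [kt [_ _ _ ktK]]] := enum_inv (ord0_lt_infinite ti).
pose code x : T := (fun z => exists t, [/\ chain n (tree_lt X f n x) t,
  z.1 = map (kl \o rank X f n) t & f (rcons t x) = ht z.2], kl (rank X f n x)).
have kl_inj x y : X x -> X y -> kl (rank X f n x) = kl (rank X f n y) ->
    rank X f n x = rank X f n y.
  by move=> Xx Xy e; rewrite -[LHS]klK ?rl // e klK ?rl.
have kl_map t t' : (forall z, z \in t -> X z) -> (forall z, z \in t' -> X z) ->
    map (kl \o rank X f n) t = map (kl \o rank X f n) t' ->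
    map (rank X f n) t = map (rank X f n) t'.
  elim: t t' => [|y t IHt] [|y' t'] //= tX tX' [e e']; congr cons.
    by apply: kl_inj e; [apply: tX|apply: tX']; rewrite mem_head.
  by apply: IHt e' => z zt; [apply: tX|apply: tX']; rewrite inE zt orbT.
apply: (cardinal_lt (aleph_inf k.+1).1 (aleph_lt1 k)).
apply: card_le_trans kX _; apply: card_le_trans Tk.
apply: (@card_le_of _ _ _ _ code) => // x x' Xx Xx' [ce re].
apply: (same_type_eq Xx Xx'); first exact: kl_inj.
move=> t t' tx tx' tt'.
have : exists t0, [/\ chain n (tree_lt X f n x') t0,
    map (kl \o rank X f n) t = map (kl \o rank X f n) t0 &
    f (rcons t0 x') = ht (kt (f (rcons t x)))].
  have := congr1 (fun P => P (map (kl \o rank X f n) t, kt (f (rcons t x)))) ce.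
  move=> /= <-; exists t; split=> //; rewrite ktK //; exact: tree_lt_X.
move=> [t0 [tx0 e0]]; rewrite ktK; last exact: tree_lt_X.
move=> <-; congr (f (rcons _ _)); apply: (map_rank_inj tx0 tx'); rewrite -tt'.
apply/esym/kl_map => //.
  by case: tx => _ _ tx z /tx /sub.
by case: tx0 => _ _ tx0 z /tx0 /sub.
Qed.

End erdos_rado.

(** * Powers below a strong limit *)

Lemma card_aleph_repr n : [set: repr (aleph n)] #<= below (aleph n) /\
  below (aleph n) #<= [set: repr (aleph n)].
Proof. by have := below_repr (aleph n); rewrite card_eq_le => /andP[]. Qed.

Lemma card_leXX n : [set: repr (aleph n) * repr (aleph n)] #<= [set: repr (aleph n)].
Proof.
have [h1 h2] := card_aleph_repr n.
apply: card_le_trans h2; apply: card_le_trans (alephX n).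
by rewrite -setXTT; exact: card_le_setX.
Qed.

Lemma card_le_pow (T U : Type) : [set: T] #<= [set: U] ->
  [set: T -> Prop] #<= [set: U -> Prop].
Proof.
have [[u _]|nu] := pselect (exists u : U, True); last first.
  have U0 : [set: U] = set0 by apply/seteqP; split => // u _; case: nu; exists u.
  rewrite U0 => /card_le0P T0; apply: (@card_le_of _ _ _ _ (fun _ _ => True)) => //.
  by move=> X Y _ _ _; apply/funext => x; have : [set: T] x by []; rewrite T0.
move=> /(card_leTP _ u)[f fi].
apply: (@card_le_of _ _ _ _ (fun X => f @` X)) => // X Y _ _ XY.
apply/seteqP; split => x Xx.
  by have : (f @` X) (f x) by [exists x]; rewrite XY => -[y Yy /fi <-].
by have : (f @` Y) (f x) by [exists x]; rewrite -XY => -[y Yy /fi <-].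
Qed.

Lemma card_le_set1 (T : Type) : [set: T] #<= [set: T -> Prop].
Proof.
apply: (@card_le_of _ _ _ _ (fun x y => x = y)) => // x y _ _ e.
by have := congr1 (fun P => P x) e => /= E; apply/esym; rewrite -E.
Qed.

(** Hausdorff's formula. If [aleph j] is at most the power set of [T], this is
    the exponent law; otherwise [j] is a successor, [T] is too short to be cofinal
    in [aleph j], and functions into [aleph j] are bounded. *)
Lemma card_fun_aleph l j (T := repr (aleph l)) :
  [set: T -> Prop] #<= below (aleph j) ->
  [set p : T -> Ord | forall i, (p i < aleph j)%O] #<= below (aleph j).
Proof.
have big i : below (aleph i) #<= [set: T -> Prop] ->
    [set: T -> Prop] #<= below (aleph i) ->
    [set p : T -> Ord | forall t, (p t < aleph i)%O] #<= below (aleph i).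
  move=> /(card_le_fun (fun=> True))[phi [_ phii]] PT.
  apply: card_le_trans PT; apply: card_le_trans (card_le_pow (card_leXX l)).
  apply: (@card_le_of _ _ _ _ (fun p (c : T * T) => phi (p c.1) c.2)) => // p q pj qj e.
  apply/funext => t; apply: phii; [exact: pj|exact: qj|].
  apply/funext => t'; exact: (congr1 (fun P => P (t, t')) e).
elim: j => [|j IH] PT.
  apply: big => //; apply: card_le_trans (card_le_set1 T).
  exact: card_le_trans (below_subset (aleph_homo (leq0n l))) (card_aleph_repr l).2.
have [jP|nP] := pselect (below (aleph j.+1) #<= [set: T -> Prop]); first exact: big.
have [c [cc Tc cT]] := small_card (T -> Prop).
have cj : (c < aleph j.+1)%O.
  rewrite ltNge; apply/negP => jc; apply: nP; apply: card_le_trans cT.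
  exact: below_subset.
have PTj := card_le_trans Tc (below_alephS cj).
have Tj := card_le_trans (card_le_set1 T) PTj.
apply: card_le_trans (card_le_bigcup (D := below (aleph j.+1))
  (F := fun c => [set p : T -> Ord | forall i, (p i < c)%O]) (card_lexx _) _).
  apply: subset_card_le => p pj.
  have [d dj pd] := aleph_bounded (aleph_lt1 j) Tj (fun i _ => pj i).
  by exists d => // i; exact: pd.
move=> d /below_alephS/(card_le_fun Defs.ord0)[g [gB gi]].
apply: card_le_trans (below_subset (ltW (aleph_lt1 j))); apply: card_le_trans (IH PTj).
apply: (@card_le_of _ _ _ _ (fun p => g \o p)) => [p pd i|p q pd qd e].
  exact: (gB _ (pd i)).
by apply/funext => i; apply: gi; [exact: pd|exact: qd|exact: (congr1 (fun h => h i) e)].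
Qed.

Lemma card_seqn (A : set Ord) k n : A #<= below (aleph k) ->
  [set s : seq Ord | size s = n /\ forall z, z \in s -> A z] #<= below (aleph k).
Proof.
move=> Ak; elim: n => [|n IH].
  apply: (@card_le_of _ _ _ _ (fun=> Defs.ord0)) => [s _|s t [/size0nil -> _] [/size0nil ->]//].
  exact/ord0_lt_infinite/aleph_inf.
apply: card_le_trans (alephX k); apply: card_le_trans (card_le_setX Ak IH).
apply: (@card_le_of _ _ _ _ (fun s => (head Defs.ord0 s, behead s))).
  move=> [|x s] [//= [sn] sA]; split; first by apply: sA; rewrite mem_head.
  by split => // z zs; apply: sA; rewrite inE zs orbT.
by move=> [|x s] [|y t] [//= _ _] [//= _ _] [-> ->].
Qed.

(** * Closed unbounded sets *)

Section clubs.
Variable k : nat.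
Let kappa := aleph k.+1.

(** The limit of [omega] many steps is a common closure point; it is below
    [kappa] since [kappa] is regular and uncountable. *)
Lemma iterate_limit (St : Ord -> Ord -> Prop) :
  (forall x, (x < kappa)%O -> exists2 y, (y < kappa)%O & (x < y)%O /\ St x y) ->
  forall x0, (x0 < kappa)%O -> exists2 d, (x0 < d)%O && (d < kappa)%O &
    forall y, (y < d)%O -> exists u v, [/\ (y <= u)%O, (u < v)%O, (v < d)%O & St u v].
Proof.
move=> St_ex x0 x0k.
have /choice[s sP] x : exists y, (x < kappa)%O -> [/\ (y < kappa)%O, (x < y)%O & St x y].
  have [/St_ex[y yk [xy sxy]]|nx] := pselect ((x < kappa)%O); first by exists y.
  by exists x.
pose u m := iter m s x0.
have uk m : (u m < kappa)%O by elim: m => //= m /sP[].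
have [||c ck uc] := @aleph_bounded _ [set: nat] u k.+1 _ (aleph_lt1 k) => //.
  by apply/infiniteP; exact: (aleph_inf k).2.
pose S := [set d | forall m, (u m < d)%O].
have Sc : S c by move=> m; exact: uc.
have Sd : S (least S) by apply: least_in; exists c.
exists (least S); first by rewrite (Sd 0%N) (le_lt_trans (least_le Sc)).
move=> y yd; have [m um] : exists m, (y <= u m)%O.
  apply: contrapT => nm; suff Sy : S y by move: (least_le Sy); rewrite leNgt yd.
  by move=> m; rewrite ltNge; apply/negP => h; apply: nm; exists m.
have [h1 h2 h3] := sP _ (uk m).
by exists (u m), (u m.+1); split => //; exact: (Sd m.+1).
Qed.

Lemma club_bigcap I (D : set I) (E : I -> set Ord) : D #<= below (aleph k) ->
  (forall i, D i -> club kappa (E i)) ->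
  club kappa [set d | (d < kappa)%O /\ forall i, D i -> E i d].
Proof.
move=> Dk Ec; split; last first.
  move=> d d0 dk lim; split=> // i Di; apply: (Ec i Di).2 => // x /lim[y [[yk yE] xy yd]].
  by exists y; split => //; exact: yE.
split=> [d []//|x xk].
have [|d /andP[xd dk] dS] := @iterate_limit (fun u v => forall i, D i ->
    exists z, [/\ E i z, (u < z)%O & (z < v)%O]) _ x xk.
- move=> u uk; have [u' u'k uu'] := aleph_succ uk.
  have /choice[z zP] i : exists z, D i -> [/\ E i z, (u < z)%O & (z < kappa)%O].
    have [Di|nD] := pselect (D i); last by exists u.
    have [z Ez u'z] := (Ec i Di).1.2 _ u'k; exists z => _; split => //.
      exact: lt_le_trans u'z.
    exact: (Ec i Di).1.1.
  have [|c ck zc] := @aleph_bounded _ D z k.+1 _ (aleph_lt1 k) Dk.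
    by move=> i /zP[].
  have [v vk cv] := aleph_succ (n := k.+1) (x := Order.max c u') ltac:(by rewrite gt_max ck).
  exists v => //; move: cv; rewrite gt_max => /andP[cv u'v]; split.
    exact: lt_trans u'v.
  move=> i Di; have [h1 h2 h3] := zP i Di; exists (z i); split => //.
  exact: lt_trans (zc _ Di) cv.
exists d; last exact: ltW.
split=> // i Di; apply: (Ec i Di).2 => //; first exact: le_lt_trans (ord0_le _) xd.
move=> y /dS[u [v [yu uv vd /(_ i Di)[z [Ez uz zv]]]]]; exists z; split => //.
  exact: le_lt_trans uz.
exact: lt_trans vd.
Qed.

Lemma club_closure n (F : seq Ord -> Ord) :
  (forall s, chain n (below kappa) s -> (F s < kappa)%O) ->
  club kappa [set d | (d < kappa)%O /\ forall s, chain n (below d) s -> (F s < d)%O].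
Proof.
have max_lt (s : seq Ord) d : (Defs.ord0 < d)%O -> (forall z, z \in s -> (z < d)%O) ->
    exists2 m, (m < d)%O & forall z, z \in s -> (z <= m)%O.
  move=> d0; elim: s => [|x s IH] sd; first by exists Defs.ord0.
  have [|m md sm] := IH; first by move=> z zs; apply: sd; rewrite inE zs orbT.
  exists (Order.max x m); first by rewrite gt_max md sd ?mem_head.
  move=> z; rewrite inE le_max => /orP[/eqP ->|/sm ->]; first by rewrite lexx.
  by rewrite orbT.
move=> Fk; split; last first.
  move=> d d0 dk lim; split=> // s [ss sn sd].
  have [m /lim[y [[yk yF] my yd]] sm] := max_lt s d d0 sd.
  apply: lt_trans yd; apply: yF; split => // z /sm zm; exact: le_lt_trans my.
split=> [d []//|x xk].
have [|d /andP[xd dk] dS] := @iterate_limit (fun u v => forall s,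
    chain n (below u) s -> (F s < v)%O) _ x xk.
- move=> u uk; have [u' u'k uu'] := aleph_succ uk.
  have [||c ck Fc] := @aleph_bounded _ (chain n (below u)) F k.+1 _ (aleph_lt1 k).
  + apply: card_le_trans (card_seqn n (below_alephS uk)); apply: subset_card_le.
    by move=> s [_ sn su].
  + by move=> s su; apply: Fk; apply: chain_sub su => z /lt_trans; exact.
  exists (Order.max c u'); first by rewrite gt_max ck.
  split; first by rewrite lt_max uu' orbT.
  by move=> s /Fc; rewrite lt_max => ->.
have d0 : (Defs.ord0 < d)%O by exact: le_lt_trans (ord0_le _) xd.
exists d; last exact: ltW.
(* [m] may equal [u], so the step is taken from the next point [u'] *)
split=> // s [ss sn sd]; have [m /dS[u [v [mu uv /dS[u' [v' [vu' _ v'd St]]] _]]] sm] := max_lt s d d0 sd.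
apply: lt_trans v'd; apply: St; split => // z /sm zm.
exact: le_lt_trans zm (le_lt_trans mu (lt_le_trans uv vu')).
Qed.

Lemma not_stationary (S : set Ord) : S `<=` below kappa -> ~ stationary kappa S ->
  exists2 C, club kappa C & forall d, C d -> ~ S d.
Proof.
move=> Sk nS; apply: contrapT => nC; apply: nS; split=> // C Cc; apply: contrapT => SC.
by apply: nC; exists C => // d Cd Sd; apply: SC; exists d.
Qed.

(** The last clause is continuity. It does not mention [E], so that an
    enumeration of part of a smaller club also enumerates part of [E]. *)
Definition enumerates (w : wellOrder) (x : w -> Ord) (E : set Ord) :=
  [/\ forall t, E (x t), forall s t, wo_lt s t -> (x s < x t)%O &
    forall t d, (Defs.ord0 < d)%O -> (forall s, wo_lt s t -> (x s < d)%O) ->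
      (forall y, (y < d)%O -> exists2 s, wo_lt s t & (y < x s)%O) -> x t = d].

Lemma enumerates_club (w : wellOrder) (E : set Ord) : [set: w] #<= below (aleph k) ->
  club kappa E -> exists x : w -> Ord, enumerates x E.
Proof.
move=> wk [[Ek Ec] El].
pose x : w -> Ord := Fix (@wo_wf w) (fun _ => Ord) (fun t rec =>
  least [set d | E d /\ forall s (st : wo_lt s t), (rec s st < d)%O]).
have xE t : x t = least [set d | E d /\ forall s, wo_lt s t -> (x s < d)%O].
  rewrite {1}/x Fix_eq; last first.
    move=> u g g' gg'; congr least; apply/seteqP; split=> d [Ed h]; split=> // s st;
    [rewrite -gg'|rewrite gg']; exact: h.
  by rewrite -/x.
have xin t : E (x t) /\ forall s, wo_lt s t -> (x s < x t)%O.
  elim/(well_founded_ind (@wo_wf w)): t => t IH.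
  rewrite [in X in E X]xE; suff : [set d | E d /\ forall s, wo_lt s t -> (x s < d)%O] !=set0.
    move=> /least_in[h1 h2]; split=> // s st; rewrite [x t]xE; exact: h2.
  have [||c ck xc] := @aleph_bounded _ [set s | wo_lt s t] x k.+1 _ (aleph_lt1 k).
  - exact: card_le_trans (card_leT _) wk.
  - by move=> s /IH[/Ek].
  have [d Ed cd] := Ec _ ck; exists d; split=> // s /xc sc; exact: lt_le_trans cd.
exists x; split=> [t|s t|t d d0 xd dx]; [exact: (xin t).1|exact: (xin t).2|].
have td : (d <= x t)%O.
  rewrite leNgt; apply/negP => /dx[s st]; rewrite ltNge => /negP; apply.
  exact/ltW/(xin t).2.
apply/eqP; rewrite eq_le td andbT xE; apply: least_le; split=> //.
apply: El => //; first by apply: le_lt_trans td _; exact/Ek/(xin t).1.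
move=> y /dx[s st ys]; exists (x s); split => //; [exact: (xin s).1|exact: xd].
Qed.

End clubs.

(** At [x t] the earlier points of the enumeration are recovered from [x t] and
    the range of [p], which is fixed before the club is known. If every [p] had a
    club as counterexample, one could intersect these clubs, as there are only
    [aleph k] many [p]; the traces along the intersection are then a [p] that its
    own club does not refute. *)
Lemma guess_trace k l (T := repr (aleph l)) (e : Ord -> Ord -> Ord) :
  [set: T -> Prop] #<= below (aleph k) ->
  (forall d x, (x < d)%O -> (d < aleph k.+1)%O -> (e d x < aleph k)%O) ->
  exists p : T -> Ord, forall E, club (aleph k.+1) E -> exists x : T -> Ord,
    enumerates x E /\ forall s t, wo_lt s t -> exists i, e (x t) (x s) = p i.
Proof.
move=> PT ek; apply: contrapT => np.
have /choice[E EP] (p : T -> Ord) : exists E, club (aleph k.+1) E /\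
    ~ exists x : T -> Ord, enumerates x E /\
      forall s t, wo_lt s t -> exists i, e (x t) (x s) = p i.
  apply: contrapT => nE; apply: np; exists p => E Ec; apply: contrapT => nx.
  by apply: nE; exists E.
have Ec := club_bigcap (card_fun_aleph PT) (fun p _ => (EP p).1).
have [x xE] := enumerates_club (card_le_trans (card_le_set1 T) PT) Ec.
have [xin xm xc] := xE.
have [j [j_inj]] : exists j : T * T -> T, injective j /\ True.
  have [h [k' _]] := enum_inv (ord0_lt_infinite (aleph_inf l)).
  have [j ji] := (card_leTP _ (k' Defs.ord0)).1 (card_leXX l).
  by exists j.
move=> _.
have /choice[p pP] i : exists a, (a < aleph k)%O /\ forall s t, wo_lt s t -> j (s, t) = i ->
    a = e (x t) (x s).
  have [[[s t] /= [st ji]]|ns] := pselect (exists c : T * T, wo_lt c.1 c.2 /\ j c = i).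
    exists (e (x t) (x s)); split.
      by apply: ek; [exact: xm|exact: (xin t).1].
    by move=> s' t' st'; rewrite -ji => /j_inj[-> ->].
  exists Defs.ord0; split; first exact/ord0_lt_infinite/aleph_inf.
  by move=> s t st ji; case: ns; exists (s, t).
have [_] := EP p; apply; exists x; split.
  split => // t; apply: (xin t).2 => i; exact: (pP i).1.
by move=> s t st; exists (j (s, t)); rewrite ((pP _).2 s t st).
Qed.

(** * Separating families of functions on a power set *)

(** By recursion: the points chosen so far are fewer than the members of the next
    set. *)
Lemma injective_selector (w : wellOrder) Y (D : w -> set Y) :
  (forall t, ~ (D t #<= [set: w])) ->
  exists y : w -> Y, injective y /\ forall t, D t (y t).
Proof.
move=> Dbig.
have /choice[c cP] (z : w * set Y) : exists u, (D z.1 `\` z.2) !=set0 -> (D z.1 `\` z.2) u.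
  have [[u Du]|nD] := pselect ((D z.1 `\` z.2) !=set0); first by exists u.
  have [u _] : D z.1 !=set0; last by exists u => /nD.
  by apply/set0P/eqP => D0; apply: (Dbig z.1); rewrite D0.
pose y : w -> Y := Fix (@wo_wf w) (fun _ => Y) (fun t rec =>
  c (t, [set u | exists s (st : wo_lt s t), rec s st = u])).
have yE t : y t = c (t, [set u | exists2 s, wo_lt s t & y s = u]).
  rewrite {1}/y Fix_eq; last first.
    move=> u g g' gg'; congr (c (_, _)); apply/seteqP; split=> v [s [st <-]];
    by exists s, st; rewrite gg'.
  rewrite -/y; congr (c (_, _)); apply/seteqP; split=> v.
    by move=> [s [st e]]; exists s.
  by move=> [s st e]; exists s, st.
have yP t : D t (y t) /\ forall s, wo_lt s t -> y s <> y t.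
  have [|h1 h2] := cP (t, [set u | exists2 s, wo_lt s t & y s = u]).
    apply: contrapT => nu; apply: (Dbig t).
    apply: (@card_le_surj _ _ _ _ y) => u Du; apply: contrapT => nu'; apply: nu.
    by exists u; split => // -[s _ e]; apply: nu'; exists s.
  by rewrite yE; split => // s st e; apply: h2; exists s.
exists y; split=> [s t e|t]; last exact: (yP t).1.
case: (wo_total s t) => // h; first by case: ((yP t).2 s h).
by case: ((yP s).2 t h).
Qed.

Section engelking_karlowicz.
Variables W K L : Type.

(** An index consists of [W * W] many points of [K] and of a table that assigns
    a value to each possible trace of a subset of [K] on these points. *)
Definition ek_index : Type := ((W * W -> K) * ((W * W -> Prop) -> L))%type.
Definition ek_fun (i : ek_index) (y : K -> Prop) : L := i.2 (y \o i.1).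

(** For [W] many distinct subsets, choose one separating point for every pair;
    the traces on these points are distinct, so the table can be filled. *)
Lemma engelking_karlowicz (k0 : K) (l0 : L) (y : W -> K -> Prop) (v : W -> L) :
  injective y -> exists i, forall t, ek_fun i (y t) = v t.
Proof.
move=> yi.
have /choice[p pP] (c : W * W) : exists k, y c.1 k = y c.2 k -> c.1 = c.2.
  have [e|ne] := pselect (c.1 = c.2); first by exists k0.
  apply: contrapT => nk; apply: ne; apply: yi; apply/funext => k.
  by apply: contrapT => yk; apply: nk; exists k.
have /choice[h hP] (u : W * W -> Prop) : exists l, forall t, u = y t \o p -> l = v t.
  have [[t ut]|nt] := pselect (exists t, u = y t \o p); last first.
    by exists l0 => t ut; case: nt; exists t.
  exists (v t) => s us; congr v; apply: (pP (t, s)) => /=.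
  exact: (congr1 (fun g => g (t, s)) (etrans (esym ut) us)).
by exists (p, h) => t; exact: hP.
Qed.

End engelking_karlowicz.

Section coding.
Variables A U L C : Type.
Let M := seq (A + (U * L + C)).

(** Prefixing embeds [A * M] in [M], so that a map from [A] to subsets of [M] can
    be stored in one subset of [M], with room left for the other two components. *)
Definition code (z : (A -> M -> Prop) * (U -> L) * C) : M -> Prop := fun m =>
  match m with
  | inl a :: m' => z.1.1 a m'
  | [:: inr (inl (u, l))] => z.1.2 u = l
  | [:: inr (inr c)] => z.2 = c
  | _ => False
  end.

Lemma code_inj : injective code.
Proof.
move=> [[p h] c] [[p' h'] c'] e.
have E m : code (p, h, c) m = code (p', h', c') m by rewrite e.
congr (_, _, _).
- by apply/funext => a; apply/funext => m; have := E (inl a :: m).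
- by apply/funext => u; have /= E' := E [:: inr (inl (u, h u))]; apply/esym; rewrite -E'.
- by have /= E' := E [:: inr (inr c)]; apply/esym; rewrite -E'.
Qed.

End coding.

(** * Homogeneous ladders along a club *)

Lemma chain_exists (m n : nat) h : mono_on (aleph m) h ->
  exists s, chain n (h @` below (aleph m)) s.
Proof.
move=> hm; suff [s [cs _]] : exists s, chain n (h @` below (aleph m)) s /\
    exists2 a, (a < aleph m)%O & forall z, z \in s -> (z < h a)%O by exists s.
elim: n => [|n [s [cs [a am sa]]]].
  by exists [::]; split => //; exists Defs.ord0 => //; exact/ord0_lt_infinite/aleph_inf.
have [b bm ab] := aleph_succ am; exists (rcons s (h a)); split.
  by apply: chain_rcons => //; exists a.
exists b => // z; rewrite mem_rcons inE => /orP[/eqP ->|/sa za]; first exact: hm.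
by apply: lt_trans za _; exact: hm.
Qed.

(** The Erdos-Rado theorem yields a homogeneous set of order type [aleph m] on an
    enumerated set [x]. As the enumeration is closed and has length
    [aleph l > aleph m], the supremum of that set is again some [x t], hence
    belongs to the club that [x] enumerates. *)
Lemma homogeneous_limit k n m theta l0 l (x : repr (aleph l) -> Ord) E
    (f : seq Ord -> Ord) :
  arrow theta n l0 m -> (l0 <= l)%N -> (m < l)%N ->
  enumerates x E -> E `<=` below (aleph k) ->
  (forall s, chain n (below (aleph k)) s -> (f s < theta)%O) ->
  exists t h c, [/\ mono_on (aleph m) h,
    forall a, (a < aleph m)%O -> exists2 s, wo_lt s t & x s = h a,
    cofinal_in (x t) (h @` below (aleph m)), cf (x t) = aleph m
    & (c < theta)%O /\ forall s, chain n (h @` below (aleph m)) s -> f s = c].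
Proof.
move=> ER l0l ml [xin xm xc] Ek ft.
have xk t : (x t < aleph k)%O by exact/Ek/xin.
have x_inj s t : x s = x t -> s = t.
  by case: (wo_total s t) => // /xm + e; rewrite e ltxx.
have [||A [AX mA [c Ac]]] := ER (range x) f.
- apply: card_le_trans (below_subset (aleph_homo l0l)) _.
  apply: card_le_trans (card_aleph_repr l).2 _.
  by apply: (@card_le_of _ _ _ _ x) => [t _|s t _ _ /x_inj //]; exists t.
- by move=> s cs; apply: ft; apply: chain_sub cs => _ [t _ <-]; exact: xk.
have [|h hm hA] := @otp_sub (aleph k) A m _ mA.
  by move=> u /AX[t _ <-]; exact: (xk t).
have hAsub : h @` below (aleph m) `<=` A by move=> _ [a am <-]; exact: hA.
have /choice[tau tauP] a : exists t, (a < aleph m)%O -> x t = h a.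
  have [/hA/AX[t _ xt]|na] := pselect ((a < aleph m)%O); first by exists t.
  have [t _] : exists t : repr (aleph l), True.
    by have /hA/AX[t _ _] := ord0_lt_infinite (aleph_inf m); exists t.
  by exists t.
have [t [t_ub t_min]] : exists t, (forall a, (a < aleph m)%O -> wo_lt (tau a) t) /\
    forall s, wo_lt s t -> ~ (forall a, (a < aleph m)%O -> wo_lt (tau a) s).
  apply: wo_min; have [g [gm gi gr]] := wo_enum (aleph l).
  have glt u : (g u < aleph l)%O by have : range g (g u) by [exists u]; rewrite gr.
  have [|||v vl tv] := @aleph_bounded _ (below (aleph m)) (g \o tau) l (aleph m).
  - by apply: lt_le_trans (aleph_lt1 m) _; exact: aleph_homo.
  - exact: card_lexx.
  - by move=> a _; exact: glt.
  have : range g v by rewrite gr.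
  move=> [u _ gu]; exists u => a am; apply: (wo_enum_lt gm); rewrite gu; exact: tv.
have ht a : (a < aleph m)%O -> (h a < x t)%O.
  by move=> am; rewrite -tauP //; apply: xm; exact: t_ub.
pose d := least [set z | forall a, (a < aleph m)%O -> (h a < z)%O].
have hd a : (a < aleph m)%O -> (h a < d)%O.
  apply: (@least_in [set z | forall a, (a < aleph m)%O -> (h a < z)%O]).
  by exists (x t).
have d_cof z : (z < d)%O -> exists2 a, (a < aleph m)%O & (z < h a)%O.
  move=> zd; have [a am za] : exists2 a, (a < aleph m)%O & (z <= h a)%O.
    apply: contrapT => na; move: zd; rewrite ltNge => /negP; apply; apply: least_le.
    by move=> a am; rewrite ltNge; apply/negP => za; apply: na; exists a.
  have [a' am' aa'] := aleph_succ am; exists a' => //.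
  by apply: le_lt_trans za _; exact: hm.
have tE : x t = d.
  apply: xc => [|s st|z /d_cof[a am za]].
  - by apply: le_lt_trans (ord0_le _) (hd Defs.ord0 _); exact/ord0_lt_infinite/aleph_inf.
  - have /existsNP[a /not_implyP[am nas]] := t_min s st.
    apply: le_lt_trans (hd a am); rewrite -tauP //.
    by case: (wo_total (tau a) s) => // [->|/xm/ltW].
  - by exists (tau a); [exact: t_ub|rewrite tauP].
have [hcof cft] : cofinal_in (x t) (h @` below (aleph m)) /\ cf (x t) = aleph m.
  apply: cofinal_range => // z; rewrite tE => /d_cof[a am za]; exists a => //.
  exact: ltW.
exists t, h, c; split => //.
  by move=> a am; exists (tau a); [exact: t_ub|exact: tauP].
split=> [|s cs]; last by apply: Ac; exact: chain_sub cs.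
have [s0 cs0] := chain_exists n hm; rewrite -(Ac s0 (chain_sub hAsub cs0)).
by apply: ft; apply: chain_sub cs0 => z /hAsub/AX[u _ <-]; exact: xk.
Qed.

(** * Guessing homogeneous ladders *)

Definition guessing_ladder n m theta k (A : Ord -> set Ord) (g : Ord -> Ord) :=
  [/\ forall d, cof_set (aleph k.+1) (aleph m) d ->
        cofinal_in d (A d) /\ otp (A d) = aleph m,
      forall d, (g d < theta)%O &
      forall f : seq Ord -> Ord,
        (forall s, chain n (below (aleph k.+1)) s -> (f s < theta)%O) ->
        stationary (aleph k.+1) [set d | cof_set (aleph k.+1) (aleph m) d /\
          forall s, chain n (A d) s -> f s = g d]].

Section guessing.
Variables (n m k l : nat) (theta : Ord).
Let kappa := aleph k.+1.
Let Lam := repr (aleph l).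

(* A guess consists of a set of traces, naming a candidate ladder at every point,
   and a colour. *)
Let Guess := ((Lam -> Prop) * repr theta)%type.

Variable w : wellOrder.
Let M := seq (w * w + ((w * w -> Prop) * Guess + repr theta)).
Let K := M -> Prop.
Let Y := K -> Prop.
Let Ind := ek_index w K Guess.

Hypothesis w_eq : [set: w] #= [set: Lam * Guess].
Hypothesis kappa_Y : below kappa #<= [set: Y].
Hypothesis K_k : [set: K] #<= below (aleph k).

Variables (ht : repr theta -> Ord) (kt : Ord -> repr theta).
Hypothesis ht_lt : forall i, (ht i < theta)%O.
Variable lam0 : Lam.
Hypothesis ktK : forall c, (c < theta)%O -> ht (kt c) = c.

Variables (b : Y -> Ord) (e : Ord -> Ord -> Ord) (p : Lam -> Ord).
Hypothesis b_inj : injective b.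
Hypothesis e_lt : forall d x, (x < d)%O -> (d < kappa)%O -> (e d x < aleph k)%O.
Hypothesis e_inj : forall d x y, (d < kappa)%O -> (x < d)%O -> (y < d)%O ->
  e d x = e d y -> x = y.

Definition cand d (Q : Lam -> Prop) :=
  [set x | (x < d)%O /\ exists2 i, Q i & e d x = p i].

Definition correct (f : seq Ord -> Ord) d (q : Guess) :=
  [/\ cofinal_in d (cand d q.1), otp (cand d q.1) = aleph m &
    forall s, chain n (cand d q.1) s -> f s = ht q.2].

Definition family_on (F : Ind -> seq Ord -> Ord) :=
  forall i s, chain n (below kappa) s -> (F i s < theta)%O.

Definition bad d (F : Ind -> seq Ord -> Ord) : set Y :=
  [set y | forall i, ~ correct (F i) d (ek_fun i y)].

(** One point of [Y] records the values at [s] of all members of the family,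
    because [Ind * repr theta] embeds in [K]; [b] turns it into an ordinal. *)
Definition family_code (F : Ind -> seq Ord -> Ord) s : Ord :=
  b (fun z => exists i c, z = code (i, c) /\ F i s = ht c).

Lemma family_code_inj F F' s : family_on F -> family_on F' ->
  chain n (below kappa) s -> family_code F s = family_code F' s ->
  forall i, F i s = F' i s.
Proof.
move=> Ft F't cs /b_inj E i; have := congr1 (fun P => P (code (i, kt (F i s)))) E.
move=> /= Ei.
have : exists i' c, code (i, kt (F i s)) = code (i', c) /\ F i' s = ht c.
  by exists i, (kt (F i s)); rewrite ktK //; exact: Ft.
rewrite Ei => -[i' [c [/code_inj[<- <-]]]].
by rewrite ktK; [move=> <-|exact: Ft].
Qed.

Lemma cand_sub d Q : cand d Q `<=` cand d (fun=> True).
Proof. by move=> x [xd [i Qi ei]]; split => //; exists i. Qed.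

Lemma bad_local d F F' : family_on F -> family_on F' -> (d < kappa)%O ->
  (forall s, chain n (cand d (fun=> True)) s -> family_code F s = family_code F' s) ->
  bad d F `<=` bad d F'.
Proof.
move=> Ft F't dk FF' y yB i [cof ot hom]; apply: (yB i); split => // s cs.
have cB := chain_sub (@cand_sub d _) cs.
rewrite -(hom s cs); apply: family_code_inj => //; last exact: FF'.
by apply: chain_sub cB => x [xd _]; exact: lt_trans dk.
Qed.

Lemma card_chain_cand d : (d < kappa)%O ->
  chain n (cand d (fun=> True)) #<= [set: Lam].
Proof.
move=> dk; apply: card_le_trans (card_aleph_repr l).2.
suff /(card_seqn n) : cand d (fun=> True) #<= below (aleph l).
  apply: card_le_trans; apply: subset_card_le => s [_ sn sB]; by split.
apply: card_le_trans (card_aleph_repr l).1.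
apply: (@card_le_surj _ _ _ _
  (fun i => xget Defs.ord0 [set x | (x < d)%O /\ e d x = p i])).
move=> x [xd [i _ ei]]; exists i => //; apply: xget_unique => // z [zd ezi].
by apply: (e_inj dk) => //; rewrite ezi.
Qed.

Lemma card_w : [set: w] #<= below (aleph k).
Proof.
apply: card_le_trans K_k; apply: card_le_trans (card_le_set1 M).
by apply: (@card_le_of _ _ _ _ (fun t => [:: inl (t, t)])) => // s t _ _ [].
Qed.

Lemma card_Guess : [set: Lam * Guess] #<= [set: w].
Proof. by move: w_eq; rewrite card_eq_le => /andP[]. Qed.

Lemma card_pow_Lam : [set: Lam -> Prop] #<= below (aleph k).
Proof.
apply: card_le_trans card_w; apply: card_le_trans card_Guess.
apply: (@card_le_of _ _ _ _ (fun Q => (lam0, (Q, kt Defs.ord0)))) => //.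
by move=> Q Q' _ _ [].
Qed.

(** The family [F] enters [bad d F] only through its codes on the candidate
    points of [d]. If these codes are below [d], they amount to a function from
    [Lam] into [d], of which there are [aleph k] many; so the small sets of bad
    points do not cover [Y]. *)
Lemma avoid_bad d : (d < kappa)%O -> (Defs.ord0 < d)%O ->
  exists y : Y, forall F, family_on F ->
    (forall s, chain n (below d) s -> (family_code F s < d)%O) ->
    bad d F #<= [set: w] -> ~ bad d F y.
Proof.
move=> dk d0; have [c [_ c_inj]] := card_le_fun lam0 (card_chain_cand dk).
pose R := [set r : Lam -> Ord | forall i, (r i < d)%O].
pose codes F (r : Lam -> Ord) :=
  forall s, chain n (cand d (fun=> True)) s -> r (c s) = family_code F s.
pose V r := [set u : Y | exists F,
  [/\ family_on F, bad d F #<= [set: w], codes F r & bad d F u]].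
have Rk : R #<= below (aleph k).
  apply: card_le_trans (card_fun_aleph card_pow_Lam).
  apply: (@card_le_of _ _ _ _ (fun r => e d \o r)) => [r rd i|r r' rd rd' ee].
    exact: (e_lt (rd i) dk).
  apply/funext => i; apply: (e_inj dk); [exact: rd|exact: rd'|].
  exact: (congr1 (fun h => h i) ee).
have Vk r : V r #<= below (aleph k).
  have [[F [Ft FB Fr]]|nF] := pselect (exists F,
      [/\ family_on F, bad d F #<= [set: w] & codes F r]).
    apply: card_le_trans card_w; apply: card_le_trans FB; apply: subset_card_le.
    move=> u [F' [F't _ F'r F'u]]; apply: bad_local F'u => // s cs.
    by rewrite -F'r ?Fr.
  suff -> : V r = set0 by exact: card_ge0.
  by apply/seteqP; split => // u [F [Ft FB Fr _]]; case: nF; exists F.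
have [y ny] : exists y, ~ (\bigcup_(r in R) V r) y.
  apply: contrapT => ny; apply: (cardinal_lt (aleph_inf k.+1).1 (aleph_lt1 k)).
  apply: card_le_trans kappa_Y _.
  apply: card_le_trans (card_le_bigcup Rk (fun r _ => Vk r)); apply: subset_card_le.
  by move=> u _; apply: contrapT => nu; apply: ny; exists u.
exists y => F Ft Fd FB Fy; apply: ny.
have /choice[r rP] i : exists a, (a < d)%O /\
    forall s, chain n (cand d (fun=> True)) s -> c s = i -> a = family_code F s.
  have [[s [cs si]]|ns] := pselect (exists s, chain n (cand d (fun=> True)) s /\ c s = i).
    exists (family_code F s); split; first by apply: Fd; apply: chain_sub cs => x [].
    by move=> s' cs' si'; congr (family_code F _); apply: c_inj => //; rewrite si si'.
  by exists Defs.ord0; split => // s cs si; case: ns; exists s.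
exists r; first by move=> i; exact: (rP i).1.
by exists F; split => // s cs; exact: (rP (c s)).2.
Qed.

Lemma cof_set_gt0 d : cof_set kappa (aleph m) d -> (Defs.ord0 < d)%O.
Proof.
move=> [_ cfd]; have [X [Xd _] oX] := cofinal_otp_cf d.
have [h hm XE] := otp_enum Xd; apply: le_lt_trans (ord0_le _) (Xd (h Defs.ord0) _).
by rewrite XE oX cfd; exists Defs.ord0 => //; exact/ord0_lt_infinite/aleph_inf.
Qed.

Variable l0 : nat.
Hypothesis l0l : (l0 <= l)%N.
Hypothesis ml : (m < l)%N.
Hypothesis ER : arrow theta n l0 m.

(** Suppose that all these bad sets were large. Distinct bad points could then be
    picked, one for each position [t] and each guess, and a single index [i]
    would attach to each of them the guess that it was picked for. But
    [homogeneous_limit] provides a position at which some guess is correct for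
    [F i]. *)
Lemma some_bad_small (F : Ind -> seq Ord -> Ord) (x : Lam -> Ord) E :
  family_on F -> enumerates x E -> E `<=` below kappa ->
  (forall s t, wo_lt s t -> exists i, e (x t) (x s) = p i) ->
  exists2 t, cof_set kappa (aleph m) (x t) & bad (x t) F #<= [set: w].
Proof.
move=> Ft xE Ek xp; apply: contrapT => nsmall.
have xk t : (x t < kappa)%O by case: xE => /(_ t)/Ek.
have [iota iota_inj] : exists f : Lam * Guess -> w, injective f.
  have [t0 _] : exists t : w, True.
    apply: contrapT => nt; move: card_Guess.
    have -> : [set: w] = set0 by apply/seteqP; split => // t _; apply: nt; exists t.
    move=> /card_le0P E0.
    have : [set: Lam * Guess] (lam0, (fun=> True, kt Defs.ord0)) by [].
    by rewrite E0.
  exact/(card_leTP _ t0)/card_Guess.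
have /choice[dec decP] (u : w) : exists z, forall z', iota z' = u -> z = z'.
  have [[z zu]|nz] := pselect (exists z, iota z = u).
    by exists z => z' zu'; apply: iota_inj; rewrite zu zu'.
  by exists (lam0, (fun=> True, kt Defs.ord0)) => z' zu'; case: nz; exists z'.
have decK z : dec (iota z) = z by exact: decP.
have [|y [y_inj yP]] := @injective_selector w Y
    (fun u => [set v | cof_set kappa (aleph m) (x (dec u).1) -> bad (x (dec u).1) F v]).
  move=> u; have [Su|nS] := pselect (cof_set kappa (aleph m) (x (dec u).1)).
    move=> h; apply: nsmall; exists (dec u).1 => //; apply: card_le_trans h.
    by apply: subset_card_le => v Fv _.
  move=> h; apply: (cardinal_lt (aleph_inf k.+1).1 (aleph_lt1 k)).
  apply: card_le_trans kappa_Y _; apply: card_le_trans card_w; apply: card_le_trans h.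
  by apply: subset_card_le => v _ /nS.
have [i iP] := engelking_karlowicz (fun=> True) (fun=> True, kt Defs.ord0)
  (fun u => (dec u).2) y_inj.
have [t [h [c [hm hx hcof cft [ct hom]]]]] := homogeneous_limit ER l0l ml xE Ek (Ft i).
pose Q (j : Lam) := exists2 a, (a < aleph m)%O & e (x t) (h a) = p j.
have hd a : (a < aleph m)%O -> (h a < x t)%O.
  by move=> /hx[s st <-]; case: xE => _ xm _; exact: xm.
have candE : cand (x t) Q = h @` below (aleph m).
  apply/seteqP; split=> [z [zd [j [a am eha] ezj]]|_ [a am <-]].
    by exists a => //; apply: (e_inj (xk t)) => //; [exact: hd|rewrite eha].
  split; first exact: hd.
  have [s st xs] := hx a am; have [j ej] := xp s t st.
  by exists j; [exists a => //|]; rewrite -xs.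
have := yP (iota (t, (Q, kt c))); rewrite /= decK => /(_ (conj (xk t) cft) i); apply.
rewrite iP decK; split; rewrite /= candE //; first exact: otp_image.
by move=> s cs; rewrite ktK // hom.
Qed.

Hypothesis trace : forall E, club kappa E -> exists x : Lam -> Ord,
  enumerates x E /\ forall s t, wo_lt s t -> exists i, e (x t) (x s) = p i.
Hypothesis b_lt : forall y, (b y < kappa)%O.

Lemma guessing_ladder_of_trace : exists A g, guessing_ladder n m theta k A g.
Proof.
pose S := cof_set kappa (aleph m).
have /choice[y yP] d : exists y : Y, S d -> forall F, family_on F ->
    (forall s, chain n (below d) s -> (family_code F s < d)%O) ->
    bad d F #<= [set: w] -> ~ bad d F y.
  have [Sd|nS] := pselect (S d); last by exists (fun=> True).
  by have [y yP] := avoid_bad Sd.1 (cof_set_gt0 Sd); exists y.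
pose isladder d A := cofinal_in d A /\ otp A = aleph m.
(* the ladder guessed by the index [i], or any ladder if that guess is not one *)
pose A (i : Ind) d : set Ord := if pselect (isladder d (cand d (ek_fun i (y d)).1))
  then cand d (ek_fun i (y d)).1 else projT1 (cid2 (cofinal_otp_cf d)).
have AP i d : S d -> isladder d (A i d).
  move=> [_ cfd]; rewrite /A; case: pselect => [//|nl] /=; case: cid2 => X Xc Xo /=.
  by split; rewrite // Xo.
apply: contrapT => noA.
have /choice[F FP] (i : Ind) : exists f,
    (forall s, chain n (below kappa) s -> (f s < theta)%O) /\
    exists2 E, club kappa E & forall d, E d -> S d -> ~ correct f d (ek_fun i (y d)).
  apply: contrapT => nf; apply: noA; exists (A i), (fun d => ht (ek_fun i (y d)).2).
  split=> [d Sd|d|f ft]; [exact: AP|exact: ht_lt|].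
  apply: contrapT => ns; apply: nf; exists f; split => //.
  have [|E Ec En] := not_stationary _ ns; first by move=> d [[]].
  exists E => // d Ed Sd [cof ot hom]; apply: (En d Ed); split => // s.
  by rewrite /A; case: pselect => [yl|[]] //=; exact: hom.
have Ft : family_on F by move=> i s; exact: (FP i).1.
have /choice[E EP] (i : Ind) : exists E, club kappa E /\
    forall d, E d -> S d -> ~ correct (F i) d (ek_fun i (y d)).
  by have [_ [E Ec En]] := FP i; exists E.
have Ind_k : [set: Ind] #<= below (aleph k).
  apply: card_le_trans K_k.
  apply: (@card_le_of _ _ _ _ (fun i => code (i, kt Defs.ord0))) => //.
  by move=> i j _ _ /code_inj[].
pose EE (c : bool) := if c then
   [set d | (d < kappa)%O /\ forall i, [set: Ind] i -> E i d] else
   [set d | (d < kappa)%O /\ forall s, chain n (below d) s -> (family_code F s < d)%O].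
have EEc c : [set: bool] c -> club kappa (EE c).
  case: c => _; first exact: club_bigcap Ind_k (fun i _ => (EP i).1).
  by apply: club_closure => s _; exact: b_lt.
have bool_k : [set: bool] #<= below (aleph k).
  have /finite_set_leP[j /card_le_trans] := @finite_finset bool setT; apply.
  apply: card_le_trans (card_leT _) _; apply/infiniteP; exact: (aleph_inf k).2.
have [x [xE xp]] := trace (club_bigcap bool_k EEc).
have [|t St small_bad] := some_bad_small Ft xE _ xp; first by move=> d [].
have [_ Ex] : (x t < kappa)%O /\ forall c, [set: bool] c -> EE c (x t).
  by case: xE => /(_ t).
apply: (yP _ St F Ft _ small_bad); first exact: (Ex false I).2.
by move=> i; apply: (EP i).2 => //; exact: (Ex true I).2.
Qed.

End guessing.

(** All auxiliary types are small because [aleph_omega] is a strong limit. The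
    size of the power set of [M -> Prop] exceeds the infinite size of
    [M -> Prop], so it is an [aleph] of successor index. *)
Lemma guessing_ladder_aleph n m theta : strong_limit aleph_omega ->
  infinite_cardinal theta -> (theta < aleph_omega)%O ->
  exists k A g, guessing_ladder n m theta k A g.
Proof.
move=> sl ti tw; have [l0 ER] := erdos_rado sl n m ti tw.
pose l := (maxn l0 m).+1.
have l0l : (l0 <= l)%N by rewrite leqW // leq_maxl.
have ml : (m < l)%N by rewrite ltnS leq_maxr.
pose Guess := ((repr (aleph l) -> Prop) * repr theta)%type.
have [w w_eq] := wo_exists (repr (aleph l) * Guess).
pose M := seq (w * w + ((w * w -> Prop) * Guess + repr theta)).
have sLam : small (repr (aleph l)) := small_repr (aleph_lt_omega l).
have sTheta : small (repr theta) := small_repr tw.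
have sGuess : small Guess by apply: small_prod => //; exact: small_pow.
have sw : small w.
  have [j wj] := small_prod sLam sGuess; exists j.
  by move: w_eq; rewrite card_eq_le => /andP[/card_le_trans + _]; apply.
have sM : small M.
  apply: (small_seq sl); apply: small_sum; first exact: small_prod.
  apply: small_sum => //; apply: small_prod => //; apply: (small_pow sl).
  exact: small_prod.
have sK := small_pow sl sM; have [j Yj] := small_pow sl sK.
have [c [cc Yc cY]] := small_card ((M -> Prop) -> Prop).
have [d [dc Kd dK]] := small_card (M -> Prop).
have dlt : (d < c)%O.
  rewrite ltNge; apply/negP => cd; apply: (@cantor (M -> Prop)).
  exact: card_le_trans Yc (card_le_trans (below_subset cd) dK).
have di : infinite_set (below d).
  move=> /(card_le_finite Kd)/(card_le_finite (card_le_set1 M)) fM.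
  have [_ [kt _]] := enum_inv (ord0_lt_infinite ti).
  apply: infinite_nat; apply: card_le_finite fM.
  apply: (@card_le_of _ _ _ _ (fun i => nseq i (inr (inr (kt Defs.ord0))) : M)) => //.
  by move=> i i' _ _ /(congr1 size); rewrite !size_nseq.
have ci : infinite_cardinal c.
  by split => // /(card_le_finite (below_subset (ltW dlt))).
have cw : (c < aleph_omega)%O.
  apply: le_lt_trans (aleph_lt_omega j); apply: cardinal_le_of => //.
  exact: card_le_trans cY Yj.
have [[|k] cE] := is_aleph ci cw.
  have : (c <= d)%O by rewrite cE; apply: aleph0P.2.
  by rewrite leNgt dlt.
have Kk : [set: M -> Prop] #<= below (aleph k).
  by apply: card_le_trans Kd _; apply: below_alephS; rewrite -cE.
rewrite cE in Yc cY.
have [ht [kt [_ ht_lt _ ktK]]] := enum_inv (ord0_lt_infinite ti).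
have [_ [kl _]] := enum_inv (ord0_lt_infinite (aleph_inf l)).
have [b [b_lt b_inj]] := card_le_fun Defs.ord0 Yc.
have /choice[e eP] z : exists e : Ord -> Ord, (z < aleph k.+1)%O ->
    (forall x, (x < z)%O -> (e x < aleph k)%O) /\
    (forall x y, (x < z)%O -> (y < z)%O -> e x = e y -> x = y).
  have [/below_alephS/(card_le_fun Defs.ord0)[e eP]|nz] := pselect ((z < aleph k.+1)%O).
    by exists e.
  by exists id.
have e_lt z x : (x < z)%O -> (z < aleph k.+1)%O -> (e z x < aleph k)%O.
  by move=> xz zk; exact: (eP z zk).1.
have [p trace] := guess_trace (card_pow_Lam w_eq Kk kt (kl Defs.ord0)) e_lt.
exists k; apply: (guessing_ladder_of_trace w_eq cY Kk ht_lt (kl Defs.ord0) ktK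
  (b := b) (e := e) (p := p)) ER trace _ => //.
- by move=> y z; exact: b_inj.
- by move=> z x y zk; exact: (eP z zk).2.
- by move=> y; exact: b_lt.
Qed.

Theorem theorem4 :
  strong_limit aleph_omega ->
  forall (n : nat), (0 < n)%N ->
  forall (mu theta : Ord),
    infinite_cardinal mu -> infinite_cardinal theta ->
    (mu <= theta)%O -> (theta < aleph_omega)%O ->
  exists kappa : Ord,
    [/\ regular_cardinal kappa, ~ countable (below kappa),
        (kappa < aleph_omega)%O &
        exists (A : Ord -> set Ord) (g : {fun below kappa >-> below theta}),
          [/\ ladder_system kappa (cof_set kappa mu) A,
              bounded_ladder mu (cof_set kappa mu) A &
              forall f : {fun increasing_tuples n (below kappa) >-> below theta},
                stationary kappa
                  [set d | cof_set kappa mu d /\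
                     f @` increasing_tuples n (A d) = [set g d]]]].
Proof.
move=> sl n _ mu theta mui thi mt tw.
have [m muE] := is_aleph mui (le_lt_trans mt tw); subst mu.
have [k [A [g [gA gt gst]]]] := guessing_ladder_aleph n m sl thi tw.
exists (aleph k.+1); split.
- by split; [exact: aleph_inf|exact: cf_aleph].
- move=> ck; apply: (cardinal_lt (aleph_inf k.+1).1 (aleph_lt1 k)).
  by apply: card_le_trans ck _; apply/infiniteP; exact: (aleph_inf k).2.
- exact: aleph_lt_omega.
have gfun : {homo g : d / below (aleph k.+1) d >-> below theta d} by move=> d _; exact: gt.
exists A, [fun of mkfun gfun].
have st : forall f : seq Ord -> Ord,
    (forall s, chain n (below (aleph k.+1)) s -> (f s < theta)%O) ->
    stationary (aleph k.+1) [set d | cof_set (aleph k.+1) (aleph m) d /\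
      f @` chain n (A d) = [set g d]].
  move=> f ft; have [sub stf] := gst f ft; split=> [d [[]]//|C /stf[d [[Sd hom] Cd]]].
  exists d; split => //; split => //; have [[Ad _] oA] := gA d Sd.
  have [h hm AE] := otp_enum Ad; rewrite oA in hm AE.
  apply/seteqP; split=> [_ [s /hom <-]//|_ ->].
  by have [s cs] := chain_exists n hm; exists s; [rewrite AE|apply: hom; rewrite AE].
split.
- split; last by move=> d /gA[].
  have [|_ st0] := st (fun=> Defs.ord0); first by move=> *; exact: ord0_lt_infinite.
  by split=> [d []//|C /st0[d [[Sd _] Cd]]]; exists d.
- by move=> d /gA[_ ->].
move=> f; pose t0 : n.-tuple Ord := nseq_tuple n Defs.ord0.
have inc_chain X (t : n.-tuple Ord) : increasing_tuples n X t <-> chain n X t.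
  by split=> [[st' tX]|[st' _ tX]]; split => //; exact: size_tuple.
have chain_inc X s : chain n X s -> increasing_tuples n X (insubd t0 s) /\
    s = insubd t0 s :> seq Ord.
  move=> cs; have e : tval (insubd t0 s) = s.
    by rewrite insubdK //; case: cs => _ /eqP.
  by split => //; apply/inc_chain; rewrite e.
have [|sub stf] := st (fun s => f (insubd t0 s)).
  by move=> s /chain_inc[/(@funS _ _ _ _ f)].
split=> [d [[]]//|C /stf[d [[Sd hom] Cd]]]; exists d; split => //; split => //.
rewrite -hom; apply/seteqP; split=> [_ [t /inc_chain tA <-]|_ [s /chain_inc[sA _] <-]].
  by exists t => //; rewrite valKd.
by exists (insubd t0 s).
Qed.
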